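(* Let $N\ge2$, $1<p_i<2$ for all $i=1,\dots,N$ and $\sum_{i=1}^N\frac1{p_i}<\frac{N+1}2$. Let $$\overline F(y)=\Big(\sum_{i=1}^N\gamma_i|y_i|^{\frac{p_i}{2-p_i}}\Big)^{-1},$$ with constants $\gamma_i>0$ satisfying $$\gamma_i\le\left[\frac{\alpha}{N}\Big(\min_j\Big\{\sigma_j\frac{p_j}{2-p_j}\Big\}-1\Big)\frac{1}{2(p_i-1)}\Big(\frac{p_i}{2-p_i}\Big)^{-p_i}\right]^{\frac1{2-p_i}},\qquad i=1,\dots,N.$$ Then, for every $R>0$, $\overline F$ is a weak supersolution in $\mathbb{R}^N\setminus B_R(0)$, and it is a classical supersolution in $\mathbb{R}^N\setminus\{0\}$, of the stationary equation $$\sum_{i=1}^N\Big[\big(|F_{y_i}|^{p_i-2}F_{y_i}\big)_{y_i}+\alpha\sigma_i\,(y_iF)_{y_i}\Big]=0 .$$ Moreover, $\overline F\in L^1(\mathbb{R}^N\setminus B_R(0))$.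
   Context: $\frac1{\overline p}=\frac1N\sum_{i=1}^N\frac1{p_i}$, $\alpha=\frac{N}{N\overline p-2N+\overline p}$, $\sigma_i=\frac1{p_i}\frac{(N+1)\overline p}{N}-1$. $B_R(0)$ is the ball of radius $R$ centered at the origin. Supersolution means that the left-hand side of the equation is $\le0$: pointwise, with the derivatives taken in the classical sense, for a classical supersolution; and in the weak (integrated by parts) sense for a weak supersolution, that is, $F_{y_i}\in L^{p_i}(\Omega)$ for all $i$ and $\sum_{i}\int_\Omega\big(|F_{y_i}|^{p_i-2}F_{y_i}+\alpha\sigma_iy_iF\big)\varphi_{y_i}\,dy\ge0$ for every nonnegative $\varphi\in C_c^\infty(\Omega)$, where $\Omega=\mathbb{R}^N\setminus\overline{B_R(0)}$.
   Formalization: If some p_i<3/2, the outer derivative of |F_{y_i}|^{p_i-2}F_{y_i} is -∞ where y_i=0, so the classical claim fails there; proved: the inequality on R^N∖{0} with -∞ allowed for it, and the literal claim at all y≠0 with y_i=0 only for p_i≥3/2. *)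

(* Defs.v *)
From HB Require Import structures.
From mathcomp Require Import all_boot all_order all_algebra.
From mathcomp Require Import all_classical all_reals all_analysis.

Set Implicit Arguments.
Unset Strict Implicit.
Unset Printing Implicit Defensive.

Import Order.TTheory GRing.Theory Num.Theory.
Import numFieldNormedType.Exports.

Local Open Scope classical_set_scope.
Local Open Scope ring_scope.

(** * Lebesgue measure on R^n, realised as ['rV[R]_n]

    The sigma-algebra is the product one, generated by the coordinates, as the
    library does for [n.-tuple T]; it is the Borel sigma-algebra of
    ['rV[R]_n]. *)

Definition rV_display : measure_display.
Proof. exact: measure_tuple_display default_measure_display. Qed.

Section measurable_rV.
Context {R : realType} {n : nat}.

Definition rV_coord (i : 'I_n) (v : 'rV[R]_n) : measurableTypeR R := v ord0 i.

Let rV_set0 : g_sigma_preimage rV_coord set0.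
Proof. exact: sigma_algebra0. Qed.

Let rV_setC A : g_sigma_preimage rV_coord A -> g_sigma_preimage rV_coord (~` A).
Proof. exact: sigma_algebraC. Qed.

Let rV_bigcup (F : (set 'rV[R]_n)^nat) :
  (forall i, g_sigma_preimage rV_coord (F i)) ->
  g_sigma_preimage rV_coord (\bigcup_i (F i)).
Proof. exact: sigma_algebra_bigcup. Qed.

HB.instance Definition _ := @isMeasurable.Build rV_display
  'rV[R]_n (g_sigma_preimage rV_coord) rV_set0 rV_setC rV_bigcup.

Lemma measurable_rV_coord (i : 'I_n) : measurable_fun setT (rV_coord i).
Proof.
move=> _ Y mY; rewrite setTI; apply: sub_sigma_algebra => /=.
rewrite -bigcup_seq/=; exists i => /=; first by rewrite mem_index_enum.
by exists Y => //; rewrite setTI.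
Qed.

Lemma measurable_fun_rVP d (T : measurableType d) (f : T -> 'rV[R]_n) :
  measurable_fun setT f <-> forall i, measurable_fun setT (rV_coord i \o f).
Proof.
split=> [mf i|mf].
  by apply: measurableT_comp => //; exact: measurable_rV_coord.
move=> _ A mA; rewrite setTI.
suff /(_ _ mA) : g_sigma_preimage rV_coord `<=`
    [set B | measurable (f @^-1` B)] by [].
apply: smallest_sub.
  split => /=; first by rewrite preimage_set0.
  - by move=> B mB; rewrite setTD preimage_setC; exact: measurableC.
  - by move=> B mB; rewrite preimage_bigcup; exact: bigcup_measurable.
move=> B; rewrite -bigcup_seq => -[i _ [C mC <-]] /=.
by rewrite setTI -comp_preimage -[X in measurable X]setTI; exact: mf.
Qed.

End measurable_rV.

Section lebesgue_rV.
Context {R : realType}.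

Definition rV_cons n (xv : measurableTypeR R * 'rV[R]_n) : 'rV[R]_n.+1 :=
  \row_i if unlift ord0 i is Some j then xv.2 ord0 j else xv.1.

Definition rV_uncons n (v : 'rV[R]_n.+1) : measurableTypeR R * 'rV[R]_n :=
  (v ord0 ord0, \row_i v ord0 (lift ord0 i)).

Lemma rV_consK n : cancel (@rV_cons n) (@rV_uncons n).
Proof.
move=> [x v]; rewrite /rV_uncons mxE unlift_none; congr pair.
by apply/rowP => i; rewrite !mxE liftK.
Qed.

Lemma measurable_rV_cons n : measurable_fun setT (@rV_cons n).
Proof.
apply/measurable_fun_rVP => i.
have [j ->|->] := unliftP ord0 i.
- rewrite [X in measurable_fun _ X](_ : _ = rV_coord j \o snd); last first.
    by apply/funext => -[x v]; rewrite /= /rV_coord mxE liftK.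
  by apply: measurableT_comp => //; exact: measurable_rV_coord.
- rewrite [X in measurable_fun _ X](_ : _ = fst) //.
  by apply/funext => -[x v]; rewrite /= /rV_coord mxE unlift_none.
Qed.

Lemma measurable_rV_uncons n : measurable_fun setT (@rV_uncons n).
Proof.
apply/measurable_fun_pairP; split; first exact: (measurable_rV_coord ord0).
apply/measurable_fun_rVP => i.
rewrite [X in measurable_fun _ X](_ : _ = rV_coord (lift ord0 i)).
  exact: measurable_rV_coord.
by apply/funext => v; rewrite /= /rV_coord mxE.
Qed.

Section succ.
Variables (n : nat) (mu : {sigma_finite_measure set 'rV[R]_n -> \bar R}).

Definition lebesgue_rV_succ : set 'rV[R]_n.+1 -> \bar R :=
  pushforward (@lebesgue_measure R \x mu)%E (@rV_cons n).

HB.instance Definition _ := Measure.copy lebesgue_rV_succ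
  (measure_function_pushforward__canonical__measure_function_Measure
     (@lebesgue_measure R \x mu)%E (@measurable_rV_cons n)).

Let lebesgue_rV_succE (A : set R) (B : set 'rV[R]_n) :
  measurable (A : set (measurableTypeR R)) -> measurable B ->
  lebesgue_rV_succ (@rV_uncons n @^-1` (A `*` B)) =
  (lebesgue_measure A * mu B)%E.
Proof.
move=> mA mB; rewrite /lebesgue_rV_succ /pushforward -comp_preimage.
rewrite (_ : _ @^-1` _ = A `*` B) ?product_measure1E//.
rewrite (_ : _ \o _ = id)//; apply/funext => xv /=.
exact: rV_consK.
Qed.

Let sigma_finite_succ : sigma_finite setT lebesgue_rV_succ.
Proof.
have /sigma_finiteP[F [TF ndF Foo]] := sigma_finiteT (@lebesgue_measure R).
have /sigma_finiteP[G [TG ndG Goo]] := sigma_finiteT mu.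
exists (fun k => @rV_uncons n @^-1` (F k `*` G k)).
  rewrite -preimage_bigcup (_ : \bigcup_i _ = setT) ?preimage_setT//.
  rewrite -setXTT TF TG predeqE => -[x y]; split.
    by move=> [k _ []/= ? ?]; split; exists k.
  move=> [/= [k _ Fkx] [l _ Gly]]; exists (maxn k l) => //; split.
  - by move: x Fkx; exact/subsetPset/ndF/leq_maxl.
  - by move: y Gly; exact/subsetPset/ndG/leq_maxr.
move=> k; have [mF Fk] := Foo k; have [mG Gk] := Goo k; split.
  rewrite -[X in measurable X]setTI.
  by apply: measurable_rV_uncons => //; exact: measurableX.
by rewrite lebesgue_rV_succE// lte_mul_pinfty// ge0_fin_numE.
Qed.

HB.instance Definition _ := Measure_isSigmaFinite.Build _ _ _
  lebesgue_rV_succ sigma_finite_succ.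

End succ.

Fixpoint lebesgue_rV n : {sigma_finite_measure set 'rV[R]_n -> \bar R} :=
  if n is m.+1 then lebesgue_rV_succ (lebesgue_rV m)
  else dirac (0 : 'rV[R]_0).

End lebesgue_rV.

Section euclidean_space.
Context {R : realType} {n : nat}.
Implicit Types (y : 'rV[R]_n) (f g phi : 'rV[R]_n -> R) (i : 'I_n).

(* The library norm on ['rV[R]_n] is the sup norm. *)
Definition enorm y : R := Num.sqrt (\sum_i y ord0 i ^+ 2).

Definition eball (r : R) : set 'rV[R]_n := [set y | enorm y < r].

Definition basis_vec i : 'rV[R]_n := delta_mx ord0 i.

Definition partial i f : 'rV[R]_n -> R := 'D_(basis_vec i) f.

Definition partial_derivable i f y : Prop := derivable f y (basis_vec i).

(* The i-th difference quotient of f at y converges in the extended reals. *)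
Definition is_ext_partial i f y (l : \bar R) : Prop :=
  (h^-1 * (f (y + h *: basis_vec i) - f y))%:E @[h --> 0^'] --> l.

Definition smooth f : Prop := forall s : seq 'I_n,
  let g := foldr partial f s in
  continuous g /\ forall i y, partial_derivable i g y.

Definition support f : set 'rV[R]_n := closure [set y | f y != 0].

(* C_c^oo(Omega), extended by zero outside Omega *)
Definition test_function (Omega : set 'rV[R]_n) phi : Prop :=
  [/\ smooth phi, compact (support phi) & support phi `<=` Omega].

Definition loc_integrable (Omega : set 'rV[R]_n) f : Prop :=
  measurable_fun Omega f /\ forall K, K `<=` Omega -> compact K ->
    (lebesgue_rV n).-integrable K (EFin \o f).

Definition is_weak_partial (Omega : set 'rV[R]_n) i f g : Prop :=
  [/\ loc_integrable Omega f, loc_integrable Omega g &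
    forall phi, test_function Omega phi ->
      \int[lebesgue_rV n]_(y in Omega) (f y * partial i phi y) =
      - \int[lebesgue_rV n]_(y in Omega) (g y * phi y)].

End euclidean_space.

Section anisotropic_p_laplacian.
Context {R : realType} {N : nat}.
Variable p : 'I_N -> R.
Implicit Types (y : 'rV[R]_N) (F : 'rV[R]_N -> R) (i : 'I_N).

Definition pbar : R := (N%:R^-1 * \sum_i (p i)^-1)^-1.

Definition alpha : R := N%:R / (N%:R * pbar - 2 * N%:R + pbar).

Definition sigma i : R := (p i)^-1 * ((N%:R + 1) * pbar / N%:R) - 1.

Definition plap_flux i (x : R) : R := `|x| `^ (p i - 2) * x.

Definition flux i F y : R := plap_flux i (partial i F y).

Definition drift i F y : R := y ord0 i * F y.

Definition classical_supersolution (U : set 'rV[R]_N) F : Prop :=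
  forall y, U y ->
  [/\ forall i, partial_derivable i F y,
      forall i, partial_derivable i (flux i F) y,
      forall i, partial_derivable i (drift i F) y &
      \sum_i (partial i (flux i F) y
              + alpha * sigma i * partial i (drift i F) y) <= 0].

(* The outer derivative of the flux may also be -oo: for the barrier below,
   (|F_i|^(p_i - 2) F_i)_i = -oo on {y_i = 0} when p_i < 3/2. The value +oo is
   excluded, so no oo - oo occurs. *)
Definition ext_classical_supersolution (U : set 'rV[R]_N) F : Prop :=
  forall y, U y -> exists l : 'I_N -> \bar R,
  [/\ forall i, partial_derivable i F y,
      forall i, is_ext_partial i (flux i F) y (l i) /\ (l i < +oo)%E,
      forall i, partial_derivable i (drift i F) y &
      (\sum_i (l i + (alpha * sigma i * partial i (drift i F) y)%:E) <= 0)%E].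

Definition weak_supersolution (Omega : set 'rV[R]_N) F : Prop :=
  exists G : 'I_N -> 'rV[R]_N -> R,
  [/\ forall i, is_weak_partial Omega i F (G i),
      forall i, G i \_ Omega \in Lfun (lebesgue_rV N) (p i)%:E &
      forall phi, test_function Omega phi -> (forall y, 0 <= phi y) ->
        0 <= \sum_i \int[lebesgue_rV N]_(y in Omega)
          ((plap_flux i (G i y) + alpha * sigma i * drift i F y)
           * partial i phi y)].

Variable gamma : 'I_N -> R.

Definition barrier_exp i : R := p i / (2 - p i).

Definition barrier y : R :=
  (\sum_i gamma i * `|y ord0 i| `^ barrier_exp i)^-1.

(* The +oo default makes the minimum over j the genuine one as soon as N > 0. *)
Definition gamma_bound i : R :=
  let m := fine (\big[mine/+oo%E]_j (sigma j * barrier_exp j)%:E) in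
  (alpha / N%:R * (m - 1) * (2 * (p i - 1))^-1 * barrier_exp i `^ (- p i))
    `^ (2 - p i)^-1.

End anisotropic_p_laplacian.

(* Main.v *)
(* Let Phi = 1 / F and m_i = p_i / (2 - p_i). Differentiating the flux gives
   (|F_i|^(p_i - 2) F_i)_i = g_i - s_i with s_i >= 0 and
   g_i = 2 (p_i - 1) (gamma_i m_i)^p_i F^(2 p_i - 1) (|y_i|^m_i)^(2 (p_i - 1)).
   As gamma_i |y_i|^m_i <= Phi, the bound on gamma_i yields
   g_i <= alpha / N (min_j sigma_j m_j - 1) F, whereas the drift terms add up to
   alpha F - alpha F^2 sum_i sigma_i m_i gamma_i |y_i|^m_i
   <= alpha F (1 - min_j sigma_j m_j), because the sigma_i sum to 1.

   For the weak inequality, the derivative of the test function is replaced by a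
   difference quotient, which translation invariance moves onto the flux. The
   flux is a nonpositive C^1 function times an increasing function of y_i, so
   its increments are bounded by those of the first factor, and only g_i
   appears in the limit even where s_i is infinite.

   Integrability uses sum_i 1 / m_i < 1, which is the hypothesis on the p_i. *)

Require Import Defs.
From mathcomp Require Import all_boot all_order all_algebra.
From mathcomp Require Import all_classical all_reals all_analysis.
From mathcomp Require Import measurable_realfun matrix_normedtype ring lra.

Set Implicit Arguments.
Unset Strict Implicit.
Unset Printing Implicit Defensive.

Import Order.TTheory GRing.Theory Num.Theory.
Import numFieldNormedType.Exports.

Local Open Scope classical_set_scope.
Local Open Scope ring_scope.

(** * Lebesgue measure on row vectors *)

(** The identity (m_i - 1) p_i = 2 (p_i - 1) m_i makes the powers of |y_i| in |F_i|^p_i and in g_i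
    powers of gamma_i |y_i|^m_i, hence controlled by powers of F. What then remains of gamma_i is
    gamma_i^(2 - p_i), the origin of the outer exponent in the bound. The hypothesis on the p_i also
    yields alpha > 0 and sigma_j m_j > 1, so that the bracket in that bound is positive. The flux
    carries |y_i| to the power (m_i - 1) (p_i - 1) = 2 (p_i - 1)^2 / (2 - p_i), which is at least 1
    exactly when p_i >= 3/2. F is singular at the origin, so functions are cut off to Omega and
    extended by zero, which destroys continuity across the boundary. Integration by parts is
    therefore set up for functions that are only measurable and bounded on cubes, with increments
    estimated on the compact support of the test function alone. *)

Section translation.
Context {R : realType}.

Let trans (a : R) : measurableTypeR R -> measurableTypeR R := fun x => x + a.

Let measurable_trans (a : R) : measurable_fun setT (trans a).
Proof. exact: measurable_funD. Qed.

(** The push-forward by a translation gives half-open intervals their length, so uniqueness of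
    Lebesgue measure applies. *)
Lemma lebesgue_measure_trans (a : R) (A : set R) :
  measurable (A : set (measurableTypeR R)) ->
  lebesgue_measure ((fun x => x + a) @^-1` A) = lebesgue_measure A.
Proof.
move=> mA; apply/esym.
pose mu : {measure set (measurableTypeR R) -> \bar R} :=
  measure_function_pushforward__canonical__measure_function_Measure
    lebesgue_measure (measurable_trans a).
apply: (@lebesgue_measure_unique R mu) => //= X [[x y] _ <-].
rewrite /mu /= /pushforward.
rewrite (_ : _ @^-1` _ = `]x - a, y - a]%classic); last first.
  by apply/seteqP; split => z /=; rewrite !in_itv/= lerBrDr ltrBlDr.
rewrite !lebesgue_measure_itv/= !lte_fin ltrD2r.
by case: ifP => // _; rewrite -!EFinB; congr EFin; ring.
Qed.

Lemma ge0_integral_trans (a : R) (f : measurableTypeR R -> \bar R) :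
  measurable_fun setT f -> (forall x, 0 <= f x)%E ->
  (\int[lebesgue_measure]_x f (x + a)%R = \int[lebesgue_measure]_x f x)%E.
Proof.
move=> mf f0.
transitivity (\int[pushforward lebesgue_measure (trans a)]_x f x)%E.
  by rewrite (ge0_integral_pushforward (measurable_trans a)).
by apply: eq_measure_integral => A mA _; exact: lebesgue_measure_trans.
Qed.

End translation.

Section lebesgue_rV_theory.
Context {R : realType}.

Lemma rV_cons0 n (xv : measurableTypeR R * 'rV[R]_n) :
  rV_cons xv ord0 ord0 = xv.1.
Proof. by rewrite mxE unlift_none. Qed.

Lemma rV_consS n (xv : measurableTypeR R * 'rV[R]_n) i :
  rV_cons xv ord0 (lift ord0 i) = xv.2 ord0 i.
Proof. by rewrite mxE liftK. Qed.

Lemma ge0_integral_rV_succ n (f : 'rV[R]_n.+1 -> \bar R) :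
  measurable_fun setT f -> (forall y, 0 <= f y)%E ->
  (\int[lebesgue_rV n.+1]_y f y =
   \int[lebesgue_measure \x lebesgue_rV n]_z f (rV_cons z))%E.
Proof.
by move=> mf f0; rewrite (ge0_integral_pushforward (@measurable_rV_cons R n)).
Qed.

Lemma rV_cons_trans0 n (x : R) (v : 'rV[R]_n) h :
  rV_cons (x, v) + h *: basis_vec ord0 = rV_cons (x + h : R, v).
Proof.
apply/rowP => i; rewrite !mxE; have [j|] := unliftP ord0 i => -> /=.
  by rewrite mulr0 addr0.
by rewrite mulr1.
Qed.

Lemma rV_cons_transS n (x : R) (v : 'rV[R]_n) h i :
  rV_cons (x, v) + h *: basis_vec (lift ord0 i) =
  rV_cons (x, v + h *: basis_vec i).
Proof.
apply/rowP => j; rewrite !mxE; have [k|] := unliftP ord0 j => -> /=.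
  by rewrite !mxE eqxx (inj_eq lift_inj).
by rewrite mulr0 addr0.
Qed.

Lemma measurable_rV_trans n (u : 'rV[R]_n) :
  measurable_fun setT (fun y : 'rV[R]_n => y + u).
Proof.
apply/measurable_fun_rVP => i.
rewrite (_ : _ \o _ = (fun y => rV_coord i y + u ord0 i : measurableTypeR R)).
  by apply: measurable_funD => //; exact: measurable_rV_coord.
by apply/funext => y; rewrite /rV_coord /= mxE.
Qed.

(** Induction on the dimension by Tonelli: the factor containing the shifted coordinate is
    integrated innermost, so that the one-dimensional result or the induction hypothesis applies
    slice by slice. *)
Lemma ge0_integral_rV_trans n (i : 'I_n) (h : R) (f : 'rV[R]_n -> \bar R) :
  measurable_fun setT f -> (forall y, 0 <= f y)%E ->
  (\int[lebesgue_rV n]_y f (y + h *: basis_vec i)%R =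
   \int[lebesgue_rV n]_y f y)%E.
Proof.
elim: n => [|n IH] in i f *; first by case: i.
move=> mf f0.
have mfc : measurable_fun setT (fun z => f (rV_cons z)).
  by apply: measurableT_comp => //; exact: measurable_rV_cons.
have mft : measurable_fun setT (fun y : 'rV[R]_n.+1 => f (y + h *: basis_vec i)).
  by apply: measurableT_comp => //; exact: measurable_rV_trans.
have mftc : measurable_fun setT (fun z => f (rV_cons z + h *: basis_vec i)).
  by apply: (measurableT_comp mft); exact: measurable_rV_cons.
rewrite !ge0_integral_rV_succ//.
case: (unliftP ord0 i) => [j|] ei; rewrite {i}ei in mft mftc *.
- rewrite !fubini_tonelli1//=; apply: eq_integral => x _.
  rewrite /fubini_F.
  under eq_integral do rewrite rV_cons_transS.
  apply: (IH _ (fun v => f (rV_cons (x, v)))) => //.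
  by apply: (measurableT_comp mfc); exact: pair1_measurable.
- rewrite !fubini_tonelli2//=; apply: eq_integral => v _.
  rewrite /fubini_G.
  under eq_integral do rewrite rV_cons_trans0.
  apply: (ge0_integral_trans _ (f := fun x => f (rV_cons (x, v)))) => //.
  by apply: (measurableT_comp mfc); exact: pair2_measurable.
Qed.

Lemma integral_rV_trans n (i : 'I_n) (h : R) (f : 'rV[R]_n -> \bar R) :
  measurable_fun setT f ->
  (\int[lebesgue_rV n]_y f (y + h *: basis_vec i)%R =
   \int[lebesgue_rV n]_y f y)%E.
Proof.
move=> mf; rewrite integralE [RHS]integralE.
rewrite -[in RHS](ge0_integral_rV_trans i h (f := f^\+%E))//; last first.
  exact: measurable_funepos.
rewrite -[X in _ = (_ - X)%E](ge0_integral_rV_trans i h (f := f^\-%E))//.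
  by congr (_ - _)%E; apply: eq_integral => y _; rewrite !(funeposE, funenegE).
exact: measurable_funeneg.
Qed.

(** Serves twice: for the finite measure of cubes, and for the integrability of the product that
    dominates the barrier. *)
Lemma ge0_integral_rV_prod n (f : 'I_n -> measurableTypeR R -> R) :
  (forall i, measurable_fun setT (f i)) -> (forall i x, 0 <= f i x) ->
  (\int[lebesgue_rV n]_y (\prod_i f i (y ord0 i))%:E =
   \prod_i \int[lebesgue_measure]_x (f i x)%:E)%E.
Proof.
elim: n => [|n IH] in f *.
  move=> mf f0; rewrite big_ord0; under eq_integral do rewrite big_ord0.
  by rewrite integral_cst//= mul1e diracT.
move=> mf f0.
have mp m (g : 'I_m -> measurableTypeR R -> R) :
    (forall i, measurable_fun setT (g i)) ->
    measurable_fun setT (fun y : 'rV[R]_m => (\prod_i g i (y ord0 i))%:E).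
  move=> mg; apply/measurable_EFinP; apply: measurable_prod => i _.
  exact: (measurableT_comp (mg i) (@measurable_rV_coord R m i)).
have p0 m (g : 'I_m -> measurableTypeR R -> R) (y : 'rV[R]_m) :
    (forall i x, 0 <= g i x) -> (0 <= (\prod_i g i (y ord0 i))%:E)%E.
  by move=> g0; rewrite lee_fin; exact: prodr_ge0.
rewrite ge0_integral_rV_succ//; [|exact: mp|by move=> y; exact: p0].
rewrite fubini_tonelli1//=; last 2 first.
- by apply: measurableT_comp (mp _ _ mf) _; exact: measurable_rV_cons.
- by move=> z; exact: p0.
rewrite big_ord_recl -IH//.
transitivity (\int[lebesgue_measure]_x ((f ord0 x)%:E *
   \int[lebesgue_rV n]_y (\prod_i f (lift ord0 i) (y ord0 i))%:E))%E.
  have mpS := mp n (fun i => f (lift ord0 i)) (fun i => mf _).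
  have p0S y := p0 n (fun i => f (lift ord0 i)) y (fun i => f0 _).
  apply: eq_integral => x _; rewrite /fubini_F -ge0_integralZl ?lee_fin//.
  apply: eq_integral => v _.
  rewrite big_ord_recl rV_cons0 EFinM; congr (_ * _%:E)%E.
  by apply: eq_bigr => i _; rewrite rV_consS.
rewrite ge0_integralZr//.
- exact/measurable_EFinP.
- by move=> x _; rewrite lee_fin.
- apply: integral_ge0 => y _.
  exact: (p0 n (fun i => f (lift ord0 i)) y (fun i => f0 _)).
Qed.

End lebesgue_rV_theory.

(** * Borel measurability and cubes *)

Section borel_rV.
Context {R : realType} {n : nat}.

Lemma measurable_rV_box (c : 'rV[R]_n) (r : R) :
  measurable [set y : 'rV[R]_n | forall i, `|y ord0 i - c ord0 i| < r].
Proof.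
rewrite (_ : [set _ | _] = \bigcap_(i in [set: 'I_n])
    (@rV_coord R n i @^-1` ball (c ord0 i) r)).
  apply: fin_bigcap_measurable => // i _; rewrite -[X in measurable X]setTI.
  by apply: measurable_rV_coord => //; exact: measurable_ball.
apply/seteqP; split => y /= h.
  by move=> i _; rewrite /rV_coord /= /ball/= distrC.
by move=> i; have := h i I; rewrite /rV_coord /= /ball/= distrC.
Qed.

(** The sigma-algebra is generated by the coordinates, so an open set has to be exhibited as a
    countable union of boxes, here with rational centres and radii 1 / (k + 1). *)
Lemma open_measurable_rV (U : set 'rV[R]_n) : open U -> measurable U.
Proof.
move=> oU.
pose box (qk : 'rV[rat]_n * nat) := [set y : 'rV[R]_n |
  forall i, `|y ord0 i - (map_mx ratr qk.1 : 'rV[R]_n) ord0 i| < qk.2.+1%:R^-1].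
(* Boxes not contained in [U] are replaced by the empty set, which keeps the index set a countable
   type. *)
have -> : U = \bigcup_qk (if pselect (box qk `<=` U) then box qk else set0).
  apply/seteqP; split => [y Uy|y [qk _]]; last by case: pselect => // h /h.
  have /nbhs_ballP[e /= e0 yeU] := open_nbhs_nbhs (conj oU Uy).
  have [k ke] : exists k : nat, k.+1%:R^-1 < e / 2.
    have e20 : 0 < e / 2 by rewrite divr_gt0.
    by have [k _ /(_ k (leqnn k))] := near_infty_natSinv_lt (PosNum e20); exists k.
  have /choice[q hq] : forall i, exists q : rat,
      `|y ord0 i - ratr q| < k.+1%:R^-1.
    move=> i; have k0 : (0 : R) < k.+1%:R^-1 by rewrite invr_gt0.
    have /rat_in_itvoo[q] : y ord0 i - k.+1%:R^-1 < y ord0 i + k.+1%:R^-1.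
      by rewrite ltrD2l (lt_trans _ k0)// oppr_lt0.
    rewrite in_itv/= => /andP[q1 q2]; exists q.
    by rewrite distrC ltr_distl q1 q2.
  exists (\row_i q i, k) => //; case: pselect => [h|[]] /=.
    by move=> i /=; rewrite !mxE.
  move=> z /= hz; apply: yeU; split => // i j; rewrite ord1 /ball /=.
  have := hz j; have := hq j; rewrite !mxE => h1 h2.
  rewrite (le_lt_trans (ler_distD (ratr (q j)) _ _))//.
  rewrite (splitr e) ltrD//; first exact: lt_trans ke.
  by rewrite distrC; exact: lt_trans ke.
apply: countable_bigcupT_measurable; first exact: countableP.
move=> qk; by case: pselect => //= h; exact: measurable_rV_box.
Qed.

Lemma continuous_measurable_rV (U : set 'rV[R]_n) (f : 'rV[R]_n -> R) :
  open U -> (forall y, U y -> {for y, continuous f}) -> measurable_fun U f.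
Proof.
move=> oU cf mU; apply: (measurability _ (RGenOInfty.measurableE R)) => //.
move=> _ [_ [a ->] <-]; rewrite preimage_itvoy.
apply: open_measurable_rV; rewrite openE => y [Uy /= ay].
apply: filterI; first exact: open_nbhs_nbhs.
exact: (cvgr_gt _ (cf _ Uy) _ ay).
Qed.

(** Written coordinatewise, so that it is at once an intersection of coordinate preimages
    (measurable) and a product of segments (compact). *)
Definition rV_cube (M : R) : set 'rV[R]_n :=
  [set y | forall i, `|y ord0 i| <= M].

Lemma measurable_rV_cube (M : R) : measurable (rV_cube M).
Proof.
rewrite (_ : rV_cube M = \bigcap_(i in [set: 'I_n])
    (@rV_coord R n i @^-1` `[- M, M])).
  apply: fin_bigcap_measurable => // i _; rewrite -[X in measurable X]setTI.
  by apply: measurable_rV_coord => //; exact: measurable_itv.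
apply/seteqP; split => y /= h.
  by move=> i _; rewrite /rV_coord /= in_itv/= -ler_norml.
by move=> i; have := h i I; rewrite /rV_coord /= in_itv/= -ler_norml.
Qed.

Lemma lebesgue_rV_cube_lty (M : R) : (lebesgue_rV n (rV_cube M) < +oo)%E.
Proof.
rewrite -[rV_cube M]setIT -integral_indic//; last exact: measurable_rV_cube.
(* The indicator of the cube is a product of one-dimensional indicators, to which the product
   formula applies. *)
rewrite (_ : (fun x => _) = (fun y : 'rV[R]_n =>
    (\prod_i \1_`[- M, M]%classic (y ord0 i))%:E)); last first.
  apply/funext => y; congr EFin; rewrite /indic.
  have [yM|/negP yM] := boolP (y \in rV_cube M).
    rewrite big1// => i _; move: yM; rewrite inE => /(_ i) yM.
    by rewrite mem_set//= in_itv/= -ler_norml.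
  apply/esym/eqP/prodf_eq0; apply: contra_notP yM => h; rewrite inE => i.
  apply: contra_notT h => yiM; exists i => //.
  by rewrite memNset//= in_itv/= -ler_norml; exact/negP.
rewrite (ge0_integral_rV_prod (f := fun=> \1_`[- M, M]%classic))//.
rewrite ltey_eq; apply/orP; left; apply: prode_fin_num => i _.
rewrite integral_indic//.
rewrite setIT [X in X \is a _]lebesgue_measure_itv/=; case: ifP => //.
Qed.

Lemma rV_coord_le_norm i (y : 'rV[R]_n) : `|y ord0 i| <= `|y|.
Proof.
rewrite [leRHS]/Num.Def.normr/= mx_normrE.
by rewrite (le_trans _ (le_bigmax _ _ (ord0, i))).
Qed.

Lemma compact_sub_rV_cube (K : set 'rV[R]_n) :
  compact K -> exists M, K `<=` rV_cube M.
Proof.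
move=> /compact_bounded[M [_ /(_ (M + 1))]]; rewrite ltrDl => /(_ ltr01) h.
exists (M + 1) => y /h yM i; exact: le_trans (rV_coord_le_norm i y) yM.
Qed.

End borel_rV.

(** * Integration by parts against test functions *)

Section tame.
Context {R : realType} {n : nat}.
Implicit Types (f g : 'rV[R]_n -> R) (i : 'I_n).

(** No continuity is asked for: extensions by zero of functions on an open set must qualify. *)
Definition locally_bounded f := measurable_fun setT f /\
  forall M, exists C, forall y, rV_cube M y -> `|f y| <= C.

Definition bounded_support f := exists M, forall y, ~ rV_cube M y -> f y = 0.

Lemma rV_cube_trans i h (y : 'rV[R]_n) M : `|h| <= 1 ->
  rV_cube M (y + h *: basis_vec i) -> rV_cube (M + 1) y.
Proof.
move=> h1 yM j; have := yM j; rewrite !mxE/= => yhM.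
rewrite -[y ord0 j](addrK (h * (j == i)%:R)).
rewrite (le_trans (ler_normB _ _))// lerD// normrM.
by case: (j == i); rewrite ?normr1 ?mulr1// normr0 mulr0.
Qed.

Lemma rV_cubeS (M M' : R) : M <= M' -> @rV_cube R n M `<=` rV_cube M'.
Proof. by move=> MM' y yM i; exact: le_trans MM'. Qed.

Lemma locally_boundedM f g : locally_bounded f -> locally_bounded g ->
  locally_bounded (fun y => f y * g y).
Proof.
move=> [mf bf] [mg bg]; split; first exact: measurable_funM.
move=> M; have [C hC] := bf M; have [D hD] := bg M; exists (C * D) => y yM.
by rewrite normrM ler_pM// ?hC ?hD.
Qed.

Lemma locally_boundedD f g : locally_bounded f -> locally_bounded g ->
  locally_bounded (fun y => f y + g y).
Proof.
move=> [mf bf] [mg bg]; split; first exact: measurable_funD.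
move=> M; have [C hC] := bf M; have [D hD] := bg M; exists (C + D) => y yM.
by rewrite (le_trans (ler_normD _ _))// lerD ?hC ?hD.
Qed.

Lemma locally_bounded_cst (k : R) : locally_bounded (fun=> k).
Proof. by split=> // M; exists `|k|. Qed.

Lemma locally_boundedN f : locally_bounded f -> locally_bounded (fun y => - f y).
Proof.
move=> /(locally_boundedM (locally_bounded_cst (-1))).
by under eq_fun do rewrite mulN1r.
Qed.

Lemma locally_boundedB f g : locally_bounded f -> locally_bounded g ->
  locally_bounded (fun y => f y - g y).
Proof. by move=> ? /locally_boundedN; exact: locally_boundedD. Qed.

Lemma locally_bounded_trans f i h : `|h| <= 1 -> locally_bounded f ->
  locally_bounded (fun y => f (y + h *: basis_vec i)).
Proof.
move=> h1 [mf bf]; split.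
  by apply: measurableT_comp => //; exact: measurable_rV_trans.
move=> M; have [C hC] := bf (M + 1); exists C => y yM; apply: hC.
apply: (@rV_cube_trans i (- h)); rewrite ?normrN//.
by rewrite scaleNr addrK.
Qed.

Lemma compact_rV_cube (M : R) : compact (@rV_cube R n M).
Proof.
rewrite (_ : rV_cube M = [set v : 'rV[R]_n |
    forall i, `[- M, M]%classic (v ord0 i)]).
  exact: (@rV_compact R n (fun=> `[- M, M]%classic)
    (fun=> @segment_compact _ _ _)).
by apply/seteqP; split => y /= h i; have := h i; rewrite /= in_itv/= -ler_norml.
Qed.

Lemma continuous_locally_bounded f : continuous f -> locally_bounded f.
Proof.
move=> cf; split.
  apply: (@continuous_measurable_rV R n setT); first exact: openT.
  by move=> y _; exact: cf.
move=> M; have /compact_bounded[C [_ /(_ (C + 1))]] :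
    compact (f @` rV_cube M).
  by apply: continuous_compact; [exact: continuous_subspaceT|
                                 exact: compact_rV_cube].
rewrite ltrDl => /(_ ltr01) hC.
by exists (C + 1) => y yM; apply: hC; exists y.
Qed.

Lemma bounded_supportMr f g :
  bounded_support g -> bounded_support (fun y => f y * g y).
Proof. by move=> [M hM]; exists M => y /hM ->; rewrite mulr0. Qed.

Lemma bounded_supportD f g : bounded_support f -> bounded_support g ->
  bounded_support (fun y => f y + g y).
Proof.
move=> [M hM] [L hL]; exists (Num.max M L) => y yML.
rewrite hM ?hL ?addr0//; apply: contra_not yML; apply: rV_cubeS.
  by rewrite le_max lexx orbT.
by rewrite le_max lexx.
Qed.

Lemma bounded_supportB f g : bounded_support f -> bounded_support g ->
  bounded_support (fun y => f y - g y).
Proof.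
move=> sf [M hM]; apply: bounded_supportD => //.
by exists M => y /hM ->; rewrite oppr0.
Qed.

Lemma bounded_support_trans f i h : `|h| <= 1 -> bounded_support f ->
  bounded_support (fun y => f (y + h *: basis_vec i)).
Proof.
move=> h1 [M hM]; exists (M + 1) => y yM; apply: hM.
by apply: contra_not yM; exact: rV_cube_trans.
Qed.

Lemma locally_bounded_integrable f : locally_bounded f -> bounded_support f ->
  (lebesgue_rV n).-integrable setT (EFin \o f).
Proof.
move=> [mf bf] [M hM]; have [C hC] := bf M.
rewrite (_ : EFin \o f = (EFin \o f) \_ (rV_cube M)).
  apply/(integrable_mkcond _ (measurable_rV_cube M)).1.
  apply: measurable_bounded_integrable.
  - exact: measurable_rV_cube.
  - exact: lebesgue_rV_cube_lty.
  - exact: measurable_funTS.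
  - exists `|C|; split; first exact: num_real.
    move=> x Cx y /= yM; rewrite (le_trans (hC _ yM))//.
    by rewrite (le_trans (ler_norm _))// ltW.
apply/funext => y; rewrite patchE; case: ifPn => //.
by rewrite notin_setE => /hM /= ->.
Qed.

Lemma Rintegral_rV_trans f i h : measurable_fun setT f ->
  \int[lebesgue_rV n]_y f (y + h *: basis_vec i) = \int[lebesgue_rV n]_y f y.
Proof.
move=> mf; congr fine.
by rewrite (integral_rV_trans i h (f := EFin \o f))//; exact/measurable_EFinP.
Qed.

End tame.

(** * Calculus along a line and uniformity on compact sets *)

Section lines.
Context {R : realType} {n : nat}.
Implicit Types (f g : 'rV[R]_n -> R) (i : 'I_n).

(** The two difference quotients coincide as functions of [h]. The one-variable mean value theorem
    and chain rule thereby become available for directional derivatives. *)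
Lemma is_derive_lineP f (y e : 'rV[R]_n) (t df : R) :
  is_derive (y + t *: e) e f df <->
  is_derive t (1 : R) (fun s => f (y + s *: e)) df.
Proof.
have E : (fun h : R => h^-1 *: (((fun s : R => f (y + s *: e)) \o shift t)
      (h *: (1 : R)) - f (y + t *: e))) =
    (fun h : R => h^-1 *: ((f \o shift (y + t *: e)) (h *: e) - f (y + t *: e))).
  apply/funext => h /=; congr (_ *: (f _ - _)).
  by rewrite scaler1 scalerDl addrCA.
split=> -[dfy dfE]; split.
- by rewrite /derivable E.
- by rewrite /derive E.
- by rewrite /derivable -E.
- by rewrite /derive -E.
Qed.

Lemma MVT_line f (y e : 'rV[R]_n) (h : R) : 0 < h ->
  (forall t, 0 <= t <= h -> derivable f (y + t *: e) e) ->
  exists2 c, 0 <= c <= h & f (y + h *: e) - f y = h * 'D_e f (y + c *: e).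
Proof.
move=> h0 df.
have dl t : 0 <= t <= h ->
    is_derive t (1 : R) (fun s => f (y + s *: e)) ('D_e f (y + t *: e)).
  by move=> /df /derivableP; move/is_derive_lineP.
have [||c] := @MVT R (fun s => f (y + s *: e))
    (fun s => 'D_e f (y + s *: e)) 0 h h0.
- by move=> x; rewrite in_itv/= => /andP[x0 xh]; apply: dl; rewrite !ltW.
- apply: derivable_within_continuous => x; rewrite in_itv/= => xh.
  by have [] := dl _ xh.
rewrite in_itv/= => /andP[c0 ch]; rewrite scale0r addr0 subr0 mulrC => ->.
by exists c => //; rewrite !ltW.
Qed.

(** Uniform continuity on [K] in the direction [e], for translates that may leave [K] but stay in
    [Omega]. With a constant [g] it is used just to keep the translates in [Omega]. *)
Lemma near_line (K Omega : set 'rV[R]_n) g (e : 'rV[R]_n) (eps : R) :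
  open Omega -> compact K -> K `<=` Omega ->
  (forall y, Omega y -> {for y, continuous g}) -> 0 < eps ->
  exists2 d, 0 < d & forall h y, `|h| < d -> K y ->
    Omega (y + h *: e) /\ `|g (y + h *: e) - g y| < eps.
Proof.
move=> oO /compact_near_coveringP cK KO cg e0.
suff /nbhs_ballP[d /= d0 hd] : \forall h \near (0 : R), K `<=`
    [set y | Omega (y + h *: e) /\ `|g (y + h *: e) - g y| < eps].
  exists d => // h y hd' Ky; apply: hd => //.
  by rewrite /ball/= sub0r normrN.
(* Compactness in its near-covering form: the property need only hold for [h] near 0 and [y] near
   each point [x] of [K]. *)
apply: (cK R (nbhs (0 : R)) (fun h y =>
  Omega (y + h *: e) /\ `|g (y + h *: e) - g y| < eps)) => x Kx.
have ct : (fun yh : 'rV[R]_n * R => yh.1 + yh.2 *: e)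
    @ filter_prod (nbhs x) (nbhs (0 : R)) --> x.
  rewrite -[in X in _ --> X](addr0 x) -[in X in _ --> X](scale0r e).
  by apply: cvgD; [exact: cvg_fst|apply: cvgZr_tmp; exact: cvg_snd].
have cgt : (fun yh : 'rV[R]_n * R => g (yh.1 + yh.2 *: e))
    @ filter_prod (nbhs x) (nbhs (0 : R)) --> g x.
  exact: (cvg_comp _ _ ct (cg _ (KO _ Kx))).
have cg1 : (fun yh : 'rV[R]_n * R => g yh.1)
    @ filter_prod (nbhs x) (nbhs (0 : R)) --> g x.
  have c1 : (fun yh : 'rV[R]_n * R => yh.1) @ filter_prod (nbhs x) (nbhs (0 : R))
      --> x by exact: cvg_fst.
  exact: (cvg_comp _ _ c1 (cg _ (KO _ Kx))).
have e20 : 0 < eps / 2 by rewrite divr_gt0.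
have nO : \forall yh \near filter_prod (nbhs x) (nbhs (0 : R)),
    Omega (yh.1 + yh.2 *: e).
  exact: ct _ (open_nbhs_nbhs (conj oO (KO _ Kx))).
move/cvgrPdistC_lt : cgt => /(_ _ e20) cgt.
move/cvgrPdist_lt : cg1 => /(_ _ e20) cg1.
have FF : Filter (filter_prod (nbhs x) (nbhs (0 : R))).
  exact: filter_prod_filter.
have := @filterI _ _ FF _ _ nO (@filterI _ _ FF _ _ cgt cg1).
apply: (@filterS _ _ FF) => -[y h] /= [Oyh [g1 g2]]; split => //.
by rewrite (le_lt_trans (ler_distD (g x) _ _))// (splitr eps) ltrD.
Qed.

End lines.

(** * Test functions and their difference quotients *)

Section test_functions.
Context {R : realType} {n : nat}.
Implicit Types (f g phi A : 'rV[R]_n -> R) (i : 'I_n) (Omega : set 'rV[R]_n).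

Lemma test_continuous Omega phi : test_function Omega phi -> continuous phi.
Proof. by move=> [/(_ [::])[]]. Qed.

Lemma test_partial_continuous Omega phi i :
  test_function Omega phi -> continuous (partial i phi).
Proof. by move=> [/(_ [:: i])[]]. Qed.

Lemma test_derivable Omega phi i y :
  test_function Omega phi -> derivable phi y (basis_vec i).
Proof. by move=> [/(_ [::])[_ /(_ i y)]]. Qed.

Lemma support0 phi y : ~ Defs.support phi y -> phi y = 0.
Proof.
move=> sy; apply: contra_notP sy => /eqP phiy0.
exact: (@subset_closure _ [set z | phi z != 0]).
Qed.

Lemma support_partial0 i phi y : ~ Defs.support phi y -> partial i phi y = 0.
Proof.
move=> sy; rewrite /partial.
have : nbhs y (~` Defs.support phi).
  apply: open_nbhs_nbhs; split => //; apply: closed_openC; exact: closed_closure.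
move=> ny; rewrite (@near_eq_derive _ _ _ _ (cst 0)) ?derive_cst//.
  by apply: filterS ny => z /support0.
Qed.

Lemma test_bounded_support Omega phi :
  test_function Omega phi -> bounded_support phi.
Proof.
move=> [_ /compact_sub_rV_cube[M hM] _]; exists M => y yM.
by apply: support0 => /hM.
Qed.

Lemma test_partial_bounded_support Omega phi i :
  test_function Omega phi -> bounded_support (partial i phi).
Proof.
move=> [_ /compact_sub_rV_cube[M hM] _]; exists M => y yM.
by apply: support_partial0 => /hM.
Qed.

(** By the mean value theorem the error is [h] times an increment of the partial derivative, which
    is small uniformly in [y] because the support is compact. *)
Lemma test_quotient Omega phi i (eps : R) : test_function Omega phi ->
  0 < eps -> exists2 d, 0 < d & forall h y, 0 < h < d ->
  `|phi (y + h *: basis_vec i) - phi y - h * partial i phi y| <= h * eps.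
Proof.
move=> tphi e0; have [_ cK _] := tphi.
have [d d0 hd] := near_line (g := partial i phi) (basis_vec i) openT cK
  (@subsetT _ _) (fun y _ => @test_partial_continuous _ _ i tphi y) e0.
exists d => // h y /andP[h0 hltd].
have [t _|c /andP[c0 ch] ->] := MVT_line (f := phi) (y := y) (e := basis_vec i) h0.
  exact: test_derivable tphi.
rewrite -mulrBr normrM gtr0_norm// ler_pM2l//.
have cd : `|c| < d by rewrite ger0_norm// (le_lt_trans ch).
(* The uniform estimate is based at a point of the support: at [y], or else at the intermediate
   point with the shift reversed. If neither lies in the support, both derivatives vanish. *)
have [yK|yK] := pselect (Defs.support phi y).
  by have [_ /ltW] := hd _ _ cd yK.
have [ycK|ycK] := pselect (Defs.support phi (y + c *: basis_vec i)).
  have [|_ /ltW] := hd (- c) _ _ ycK; first by rewrite normrN.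
  by rewrite scaleNr addrK distrC.
by rewrite -/(partial i phi _) !support_partial0// subrr normr0 ltW.
Qed.

(* By translation invariance, the difference quotient of [phi] in the integral
   against [A] can be moved onto [A]. *)
Lemma integral_partial_quotient Omega phi i A (eps : R) :
  test_function Omega phi -> locally_bounded A -> 0 < eps ->
  exists2 d, 0 < d & forall h, 0 < h < d ->
  `|h * \int[lebesgue_rV n]_y (A y * partial i phi y)
    - \int[lebesgue_rV n]_y ((A (y - h *: basis_vec i) - A y) * phi y)|
    <= h * eps.
Proof.
move=> tphi bA e0; set mu := lebesgue_rV n.
have [_ cK _] := tphi; have [M hM] := compact_sub_rV_cube cK.
have bphi := continuous_locally_bounded (test_continuous tphi).
have bdphi := continuous_locally_bounded (test_partial_continuous (i := i) tphi).
have sphi := test_bounded_support tphi.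
have sdphi := test_partial_bounded_support i tphi.
(* The enlarged cube contains the supports of [phi] and of all its shifts by at most 1, so [I]
   localises the error of the quotient. *)
pose I : 'rV[R]_n -> R := \1_(rV_cube (M + 1)).
have bI : locally_bounded I.
  split; first by apply: measurable_indic; exact: measurable_rV_cube.
  by move=> L; exists 1 => y _; rewrite /I indicE ger0_norm ?ler0n// lern1 leq_b1.
have sI : bounded_support I.
  by exists (M + 1) => y yM; rewrite /I indicE memNset.
have bnA : locally_bounded (fun y => `|A y|).
  case: bA => mA bA; split; first exact: measurableT_comp.
  by move=> L; have [C hC] := bA L; exists C => y /hC; rewrite normr_id.
have iAI : mu.-integrable setT (EFin \o (fun y => `|A y| * I y)).
  apply: locally_bounded_integrable; first exact: locally_boundedM.
  exact: bounded_supportMr.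
pose B := \int[mu]_y (`|A y| * I y).
have B0 : 0 <= B.
  by apply: Rintegral_ge0 => y _; rewrite mulr_ge0// /I indicE ler0n.
(* The pointwise error gets integrated against [|A|] over the cube, which multiplies it by [B]; the
   added 1 covers [B = 0]. *)
have eB0 : 0 < eps / (B + 1) by rewrite divr_gt0// ltr_wpDl.
have [d d0 hd] := test_quotient i tphi eB0.
exists (Num.min d 1); first by rewrite lt_min d0 ltr01.
move=> h /andP[h0]; rewrite lt_min => /andP[hltd hlt1].
have h1 : `|h| <= 1 by rewrite gtr0_norm// ltW.
have hN1 : `|- h| <= 1 by rewrite normrN.
have bphih := locally_bounded_trans i h1 bphi.
have sphih := bounded_support_trans i h1 sphi.
have bAh := locally_bounded_trans i hN1 bA.
(* Splitting the difference allows the first integral alone to be translated by [h]. *)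
have E1 : \int[mu]_y ((A (y - h *: basis_vec i) - A y) * phi y) =
    \int[mu]_y (A y * (phi (y + h *: basis_vec i) - phi y)).
  transitivity (\int[mu]_y (A (y + - h *: basis_vec i) * phi y)
      - \int[mu]_y (A y * phi y)).
    rewrite -RintegralB//; first last.
    - apply: locally_bounded_integrable; first exact: locally_boundedM.
      exact: bounded_supportMr.
    - apply: locally_bounded_integrable; first exact: locally_boundedM.
      exact: bounded_supportMr.
    by apply: eq_Rintegral => y _; rewrite mulrBl scaleNr.
  rewrite -(Rintegral_rV_trans i h
    (f := fun y => A (y + - h *: basis_vec i) * phi y)); last first.
    by have [] := locally_boundedM bAh bphi.
  rewrite -RintegralB//; first last.
  - apply: locally_bounded_integrable; first exact: locally_boundedM.
    exact: bounded_supportMr.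
  - under eq_fun do rewrite scaleNr addrK.
    apply: locally_bounded_integrable; first exact: locally_boundedM.
    exact: bounded_supportMr.
  by apply: eq_Rintegral => y _; rewrite scaleNr addrK mulrBr.
have bD := locally_boundedB bphih bphi.
have sD := bounded_supportB sphih sphi.
have iD : mu.-integrable setT
    (EFin \o (fun y => A y * (phi (y + h *: basis_vec i) - phi y))).
  apply: locally_bounded_integrable; first exact: locally_boundedM.
  exact: bounded_supportMr.
have iP : mu.-integrable setT (EFin \o (fun y => A y * partial i phi y)).
  apply: locally_bounded_integrable; first exact: locally_boundedM.
  exact: bounded_supportMr.
have ihP : mu.-integrable setT (EFin \o (fun y => h * (A y * partial i phi y))).
  exact: (integrableZl measurableT h iP).
rewrite E1 -RintegralZl// -RintegralB//.
rewrite (le_trans (le_normr_Rintegral _ _))//.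
  exact: (integrableB measurableT ihP iD).
have -> : h * eps = h * (eps / (B + 1)) * (B + 1).
  by rewrite -mulrA divfK// gt_eqF// ltr_wpDl.
apply: (@le_trans _ _ (h * (eps / (B + 1)) * B)); last first.
  by rewrite ler_wpM2l ?lerDl//; apply: mulr_ge0; exact: ltW.
rewrite /B -RintegralZl//; apply: le_Rintegral => //.
- apply: integrable_norm; exact: (integrableB measurableT ihP iD).
- exact: (integrableZl measurableT (h * (eps / (B + 1))) iAI).
move=> y _ /=; rewrite mulrCA -mulrBr normrM mulrCA.
apply: ler_wpM2l => //; have [yM|yM] := pselect (rV_cube (M + 1) y).
  by rewrite /I indicE mem_set// mulr1 distrC hd// h0.
have yM' : ~ rV_cube M y by apply: contra_not yM; apply: rV_cubeS; rewrite lerDl.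
rewrite /I indicE memNset// mulr0 support_partial0; last by move=> /hM.
rewrite mulr0 !support0 ?subrr ?normr0//; first by move=> /hM.
by move=> /hM/(rV_cube_trans h1).
Qed.

End test_functions.

(** * Integration by parts from increment estimates *)

Section weak_derivatives.
Context {R : realType} {n : nat}.
Implicit Types (f g phi A : 'rV[R]_n -> R) (i : 'I_n) (Omega : set 'rV[R]_n).

Lemma restrictM Omega f g :
  (fun y => f y * g y) \_ Omega = (fun y => (f \_ Omega) y * g y).
Proof.
by apply/funext => y; rewrite !patchE; case: ifP => // _; rewrite mul0r.
Qed.

Lemma Rintegral_restrictM Omega f g :
  \int[lebesgue_rV n]_(y in Omega) (f y * g y) =
  \int[lebesgue_rV n]_y ((f \_ Omega) y * g y).
Proof. by rewrite Rintegral_mkcond restrictM. Qed.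

Lemma restrict_integrable Omega f g : measurable Omega ->
  locally_bounded (f \_ Omega) -> locally_bounded g -> bounded_support g ->
  (lebesgue_rV n).-integrable Omega (EFin \o (fun y => f y * g y)).
Proof.
move=> mO bf bg sg; apply/(integrable_mkcond _ mO).2.
rewrite restrict_EFin restrictM.
apply: locally_bounded_integrable; first exact: locally_boundedM.
exact: bounded_supportMr.
Qed.

(* Weighting the bound by [phi] makes a one-sided estimate of the increments of
   [A] enough if [0 <= phi], and a two-sided one enough for any sign. *)
Lemma ibp_le Omega phi i A g : open Omega -> test_function Omega phi ->
  locally_bounded (A \_ Omega) -> locally_bounded (g \_ Omega) ->
  (forall eps, 0 < eps -> exists2 d, 0 < d & forall h y, 0 < h < d ->
    Defs.support phi y ->
    (A y - A (y - h *: basis_vec i) - h * g y) * phi y <= h * eps * `|phi y|) ->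
  - (\int[lebesgue_rV n]_(y in Omega) (g y * phi y)) <=
  \int[lebesgue_rV n]_(y in Omega) (A y * partial i phi y).
Proof.
move=> oO tphi bA bg H; have [_ cK KO] := tphi.
rewrite !(Rintegral_restrictM Omega).
set A' := A \_ Omega in bA *; set g' := g \_ Omega in bg *.
set mu := lebesgue_rV n.
have bphi := continuous_locally_bounded (test_continuous tphi).
have sphi := test_bounded_support tphi.
have bnphi : locally_bounded (fun y => `|phi y|).
  case: bphi => mphi bphi; split; first exact: measurableT_comp.
  by move=> L; have [C hC] := bphi L; exists C => y /hC; rewrite normr_id.
have snphi : bounded_support (fun y => `|phi y|).
  by case: sphi => M hM; exists M => y /hM ->; rewrite normr0.
have iphi := locally_bounded_integrable bnphi snphi.
pose P := \int[mu]_y `|phi y|.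
have P0 : 0 <= P by apply: Rintegral_ge0 => y _.
apply/ler_addgt0Pr => eps eps0.
(* With e = eps / (P + 1), the estimate on [A] costs h e P after integration and the quotient of
   [phi] costs h e: in all h eps, which is then divided by [h]. *)
have e0 : 0 < eps / (P + 1) by rewrite divr_gt0// ltr_wpDl.
have [d1 d10 h1] := integral_partial_quotient i tphi bA e0.
have [d2 d20 h2] := H _ e0.
(* This keeps the backward translates of the support in [Omega], where the extension by zero still
   agrees with [A]. *)
have [d3 d30 h3] := near_line (g := fun=> 0 : R) (basis_vec i) oO cK KO
  (fun y _ => cvg_cst _) ltr01.
pose d := Num.min (Num.min d1 d2) (Num.min d3 1).
have d0 : 0 < d by rewrite !lt_min d10 d20 d30/=.
pose h := d / 2.
have h0 : 0 < h by rewrite divr_gt0.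
have : h < d by rewrite /h ltr_pdivrMr// mulr_natr mulr2n ltrDl.
rewrite !lt_min => /andP[/andP[hd1 hd2] /andP[hd3 hlt1]].
have hN1 : `|- h| <= 1 by rewrite normrN gtr0_norm// ltW.
have {}h1 := h1 h; rewrite h0 hd1 /= in h1; have {}h1 := h1 isT.
have bAh : locally_bounded (fun y => A' (y - h *: basis_vec i)).
  by have := locally_bounded_trans i hN1 bA; under eq_fun do rewrite scaleNr.
have bD := locally_boundedB bAh bA.
have iD := locally_bounded_integrable (locally_boundedM bD bphi)
  (bounded_supportMr _ sphi).
have ig := locally_bounded_integrable (locally_boundedM bg bphi)
  (bounded_supportMr _ sphi).
have key : - h * \int[mu]_y (g' y * phi y) - h * (eps / (P + 1)) * P <=
    \int[mu]_y ((A' (y - h *: basis_vec i) - A' y) * phi y).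
  rewrite -!RintegralZl// -RintegralB//; last 2 first.
  - exact: (integrableZl measurableT (- h) ig).
  - exact: (integrableZl measurableT (h * (eps / (P + 1))) iphi).
  apply: le_Rintegral => //.
    exact: (integrableB measurableT (integrableZl measurableT (- h) ig)
      (integrableZl measurableT (h * (eps / (P + 1))) iphi)).
  move=> y _; have [yK|yK] := pselect (Defs.support phi y); last first.
    by rewrite (support0 yK) !mulr0 normr0 mulr0 subr0.
  have [Oy _] : Omega (y - h *: basis_vec i) /\ `|0 - 0 : R| < 1.
    by rewrite -scaleNr; apply: h3 => //; rewrite normrN gtr0_norm.
  have := h2 h y; rewrite h0 hd2 => /(_ isT yK).
  rewrite /A' /g' !patchE !mem_set//; last exact: KO.
  lra.
have key2 : - h * \int[mu]_y (g' y * phi y) - h * (eps / (P + 1)) * P <=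
    h * \int[mu]_y (A' y * partial i phi y) + h * (eps / (P + 1)).
  apply: (le_trans key); move: h1; rewrite ler_norml => /andP[+ _].
  lra.
rewrite -(ler_pM2l h0) mulrDr.
have -> : h * eps = h * (eps / (P + 1)) * P + h * (eps / (P + 1)).
  by rewrite -[X in _ = _ + X]mulr1 -mulrDr -mulrA divfK// gt_eqF// ltr_wpDl.
move: key2; lra.
Qed.

(** The version for the flux, whose increments are controlled from above only. *)
Lemma ibp_ge0 Omega phi i A g : open Omega -> test_function Omega phi ->
  (forall y, 0 <= phi y) ->
  locally_bounded (A \_ Omega) -> locally_bounded (g \_ Omega) ->
  (forall K, compact K -> K `<=` Omega ->
    forall eps, 0 < eps -> exists2 d, 0 < d & forall h y, 0 < h < d -> K y ->
    A y - A (y - h *: basis_vec i) <= h * (g y + eps)) ->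
  - (\int[lebesgue_rV n]_(y in Omega) (g y * phi y)) <=
  \int[lebesgue_rV n]_(y in Omega) (A y * partial i phi y).
Proof.
move=> oO tphi phi0 bA bg H; apply: ibp_le => // eps e0.
have [_ cK KO] := tphi; have [d d0 hd] := H _ cK KO _ e0; exists d => // h y hh Ky.
by rewrite ger0_norm// ler_wpM2r//; have := hd h y hh Ky; lra.
Qed.

(** The mean value theorem and the continuity of [g] bound the increments of [A] on both sides, so
    [ibp_le] applies to [A] and to [- A]. *)
Lemma ibp_eq Omega phi i A g : open Omega -> test_function Omega phi ->
  locally_bounded (A \_ Omega) -> locally_bounded (g \_ Omega) ->
  (forall y, Omega y -> derivable A y (basis_vec i)) ->
  (forall y, Omega y -> partial i A y = g y) ->
  (forall y, Omega y -> {for y, continuous g}) ->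
  \int[lebesgue_rV n]_(y in Omega) (A y * partial i phi y) =
  - \int[lebesgue_rV n]_(y in Omega) (g y * phi y).
Proof.
move=> oO tphi bA bg dA Ag cg; have [_ cK KO] := tphi.
have mO := open_measurable_rV oO.
have H eps : 0 < eps -> exists2 d, 0 < d & forall h y, 0 < h < d ->
    Defs.support phi y ->
    `|A y - A (y - h *: basis_vec i) - h * g y| <= h * eps.
  move=> e0; have [d d0 hd] := near_line (basis_vec i) oO cK KO cg e0.
  exists d => // h y /andP[h0 hltd] yK.
  have hd' t : - h <= t <= 0 -> Omega (y + t *: basis_vec i) /\
      `|g (y + t *: basis_vec i) - g y| < eps.
    move=> /andP[t1 t2]; apply: hd => //.
    by rewrite ler0_norm// (le_lt_trans _ hltd)// lerNl.
  have sh t : y - h *: basis_vec i + t *: basis_vec i =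
      y + (t - h) *: basis_vec i.
    by rewrite scalerBl addrAC addrA.
  have [t /andP[t0 th]|c /andP[c0 ch]] := MVT_line (f := A)
      (y := y - h *: basis_vec i) (e := basis_vec i) h0.
    by rewrite sh; apply/dA/(proj1 (hd' _ _)); rewrite lerBlDr lerBrDr; lra.
  rewrite !sh subrr scale0r addr0 => ->.
  have [Oc gc] : Omega (y + (c - h) *: basis_vec i) /\
     `|g (y + (c - h) *: basis_vec i) - g y| < eps.
    by apply: hd'; lra.
  rewrite -/(partial i A _) Ag// -mulrBr normrM gtr0_norm// ler_pM2l//.
  exact: ltW.
have bphi := continuous_locally_bounded (test_continuous tphi).
have sphi := test_bounded_support tphi.
have bdphi := continuous_locally_bounded (test_partial_continuous (i := i) tphi).
have sdphi := test_partial_bounded_support i tphi.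
have NE f : (fun y => - f y) \_ Omega = (fun y => - (f \_ Omega) y).
  by apply/funext => y; rewrite !patchE; case: ifP => // _; rewrite oppr0.
apply/eqP; rewrite eq_le; apply/andP; split.
  have := @ibp_le Omega phi i (fun y => - A y) (fun y => - g y) oO tphi.
  rewrite !NE => /(_ (locally_boundedN bA) (locally_boundedN bg)).
  have -> : \int[lebesgue_rV n]_(y in Omega) (- g y * phi y) =
      - (\int[lebesgue_rV n]_(y in Omega) (g y * phi y)).
    rewrite -mulN1r -RintegralZl//; last exact: restrict_integrable.
    by apply: eq_Rintegral => y _; rewrite mulN1r mulNr.
  have -> : \int[lebesgue_rV n]_(y in Omega) (- A y * partial i phi y) =
      - \int[lebesgue_rV n]_(y in Omega) (A y * partial i phi y).
    rewrite -mulN1r -RintegralZl//; last exact: restrict_integrable.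
    by apply: eq_Rintegral => y _; rewrite mulN1r mulNr.
  rewrite lerN2; apply=> eps e0.
  have [d d0 hd] := H _ e0; exists d => // h y hh yK.
  rewrite (le_trans (ler_norm _))// normrM ler_wpM2r//.
  by rewrite mulrN -!opprD normrN; exact: hd.
apply: ibp_le => // eps e0; have [d d0 hd] := H _ e0; exists d => // h y hh yK.
by rewrite (le_trans (ler_norm _))// normrM ler_wpM2r// hd.
Qed.

End weak_derivatives.

(** * The barrier and its classical derivatives *)

Section signed_power.
Context {R : realType}.
Implicit Types (a b x : R).

(** The odd power function. It vanishes at 0 for every exponent, and the derivative of |x|^a is a
    multiple of it. *)
Definition spow b x := Num.sg x * `|x| `^ b.

Lemma spow0 b : spow b 0 = 0.
Proof. by rewrite /spow sgr0 mul0r. Qed.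

Lemma spow_pos b x : 0 < x -> spow b x = x `^ b.
Proof. by move=> x0; rewrite /spow gtr0_sg// mul1r gtr0_norm. Qed.

Lemma spow_neg b x : x < 0 -> spow b x = - (- x) `^ b.
Proof. by move=> x0; rewrite /spow ltr0_sg// mulN1r ltr0_norm. Qed.

Lemma norm_spow b x : `|spow b x| <= `|x| `^ b.
Proof.
rewrite /spow normrM normr_sg (ger0_norm (powR_ge0 _ _)).
by case: (x == 0); rewrite ?mul0r ?mul1r// powR_ge0.
Qed.

(** The indicator is there for x = 0: the left side vanishes, whereas 0 to the power 0 is 1. *)
Lemma spowM a b x : spow a x * spow b x = (x != 0)%:R * `|x| `^ (a + b).
Proof.
have [->|x0] := eqVneq x 0; first by rewrite !spow0 !mul0r.
rewrite /spow mulrACA -expr2 sqr_sg x0 !mul1r powRD//.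
by rewrite normr_eq0 x0 implybT.
Qed.

Lemma mul_spow b x : 0 < b -> x * spow (b - 1) x = `|x| `^ b.
Proof.
move=> b0; have [->|x0] := eqVneq x 0.
  by rewrite mul0r normr0 powR0// gt_eqF.
by rewrite /spow mulrA (mulrC x) -normrEsg mulr_powRB1.
Qed.

Lemma ler_spow b : 0 < b -> {homo spow b : x y / x <= y}.
Proof.
move=> b0 x y xy; case: (ltgtP 0 x) => x0.
- rewrite !spow_pos//; last exact: lt_le_trans xy.
  have y0 := lt_le_trans x0 xy.
  by apply: ge0_ler_powR; rewrite ?nnegrE//; exact: ltW.
- case: (ltgtP 0 y) => y0.
  + rewrite (spow_pos _ y0) spow_neg// (@le_trans _ _ 0)// ?powR_ge0//.
    by rewrite oppr_le0 powR_ge0.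
  + rewrite !spow_neg// lerN2.
    by apply: ge0_ler_powR; rewrite ?nnegrE ?oppr_ge0 ?lerN2//; exact: ltW.
  + by rewrite -y0 spow0 spow_neg// oppr_le0 powR_ge0.
- subst x; rewrite spow0; move: xy; rewrite le_eqVlt => /predU1P[<-|y0].
    by rewrite spow0.
  by rewrite spow_pos// powR_ge0.
Qed.

Lemma powR_norm_lt b (eps : R) : 0 < b -> 0 < eps ->
  \forall x \near (0 : R), `|x| `^ b < eps.
Proof.
move=> b0 e0; apply/nbhs_ballP; exists (eps `^ b^-1); first exact: powR_gt0.
move=> x; rewrite /ball/= sub0r normrN => xe.
rewrite -[ltRHS](powRr1 (ltW e0)) -(mulVf (lt0r_neq0 b0)) powRrM.
by apply: gt0_ltr_powR; rewrite ?nnegrE// powR_ge0.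
Qed.

Lemma is_derive_normr_powR a x : x != 0 ->
  is_derive x (1 : R) (fun x => `|x| `^ a) (a * spow (a - 1) x).
Proof.
rewrite neq_lt => /orP[x0|x0]; last first.
  rewrite spow_pos//; have := is_derive1_powR a x0.
  apply: near_eq_is_derive => //.
  by near=> z; rewrite gtr0_norm//; near: z; exact: lt_nbhsr.
rewrite spow_neg// mulrN.
have xN0 : 0 < - x by rewrite oppr_gt0.
have h := is_derive1_powR a xN0.
have : is_derive x (1 : R) ((fun z : R => z `^ a) \o -%R)
    (a * (- x) `^ (a - 1) * -1).
  exact: is_derive1_comp.
rewrite mulrN1; apply: near_eq_is_derive => //.
by near=> z; rewrite /= ltr0_norm//; near: z; exact: lt_nbhsl.
Unshelve. all: by end_near. Qed.

Lemma is_derive_normr_powR_gt1 a x : 1 < a ->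
  is_derive x (1 : R) (fun x => `|x| `^ a) (a * spow (a - 1) x).
Proof.
move=> a1; have [->|] := eqVneq x 0; last exact: is_derive_normr_powR.
rewrite spow0 mulr0.
have a0 : 0 < a by rewrite (lt_trans _ a1).
(* At 0 the quotient has absolute value |h|^(a - 1), which tends to 0 as a > 1. *)
have : h^-1 *: (((fun x : R => `|x| `^ a) \o shift 0) (h *: (1 : R))
    - `|(0 : R)| `^ a) @[h --> (0 : R)^'] --> (0 : R).
  apply/cvgr0Pnorm_lt => e e0.
  have := powR_norm_lt _ e0 => /(_ (a - 1)); rewrite subr_gt0 => /(_ a1).
  move=> /nbhs_dnbhs; apply: filterS => h /=.
  rewrite addr0 normr0 powR0 ?gt_eqF// subr0 scaler1 normrZ normfV.
  rewrite (ger0_norm (powR_ge0 _ _)); have [->|h0] := eqVneq h 0.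
    by rewrite normr0 invr0 mul0r.
  rewrite powRB ?normr_eq0 ?h0 ?implybT//.
  by rewrite powRr1 // mulrC.
by move=> h; split; [apply/cvg_ex; exists 0|exact: cvg_lim h].
Qed.

Lemma is_derive_spow b x : x != 0 ->
  is_derive x (1 : R) (spow b) (b * `|x| `^ (b - 1)).
Proof.
move=> x0; have [xp|xn] : 0 < x \/ x < 0.
- by move: x0; rewrite neq_lt => /orP[]; [right|left].
- rewrite gtr0_norm//; apply: near_eq_is_derive (is_derive1_powR b xp).
  by near=> z; rewrite spow_pos//; near: z; exact: lt_nbhsr.
- have h := is_derive_normr_powR b x0.
  have E : b * `|x| `^ (b - 1) = - (b * spow (b - 1) x).
    by rewrite spow_neg// ltr0_norm// mulrN opprK.
  rewrite E; apply: near_eq_is_derive (is_deriveN h).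
  near=> z; rewrite spow_neg/=; last by near: z; exact: lt_nbhsl.
  by rewrite fctE/= ltr0_norm//; near: z; exact: lt_nbhsl.
Unshelve. all: by end_near. Qed.

Lemma is_derive_spow0 b : 1 <= b ->
  is_derive (0 : R) (1 : R) (spow b) (b * `|(0 : R)| `^ (b - 1)).
Proof.
rewrite le_eqVlt => /predU1P[<-|b1].
  (* For b = 1 the formula gives the right value 1 at the origin because 0 to the power 0 is 1. *)
  rewrite subrr powRr0 mulr1 (_ : spow 1 = id); first exact: is_derive_id.
  by apply/funext => x; rewrite /spow powRr1// -numEsg.
rewrite normr0 powR0 ?mulr0; last by rewrite subr_eq0 gt_eqF.
have : h^-1 *: ((spow b \o shift 0) (h *: (1 : R)) - spow b 0)
    @[h --> (0 : R)^'] --> (0 : R).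
  apply/cvgr0Pnorm_lt => e e0.
  have := powR_norm_lt _ e0 => /(_ (b - 1)); rewrite subr_gt0 => /(_ b1).
  move=> /nbhs_dnbhs; apply: filterS => h /=.
  rewrite addr0 spow0 subr0 scaler1 normrZ normfV.
  have [->|h0] := eqVneq h 0; first by rewrite normr0 invr0 mul0r.
  rewrite powRB ?normr_eq0 ?h0 ?implybT// powRr1// mulrC.
  apply: le_lt_trans; rewrite ler_pM2l ?invr_gt0 ?normr_gt0//.
  exact: norm_spow.
by move=> h; split; [apply/cvg_ex; exists 0|exact: cvg_lim h].
Qed.

Lemma continuous_spow b : 0 < b -> continuous (spow b).
Proof.
move=> b0 x; have [->|x0] := eqVneq x 0; last first.
  have [dx _] := is_derive_spow b x0.
  by apply: differentiable_continuous; exact/derivable1_diffP.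
rewrite /continuous_at spow0; apply/cvgr0Pnorm_lt => e e0.
apply: filterS (powR_norm_lt b0 e0) => z; exact/le_lt_trans/norm_spow.
Qed.

Lemma continuous_normr_powR b : 0 < b -> continuous (fun x : R => `|x| `^ b).
Proof.
move=> b0 x; have [->|x0] := eqVneq x 0; last first.
  have [dx _] := is_derive_normr_powR b x0.
  by apply: differentiable_continuous; exact/derivable1_diffP.
rewrite /continuous_at normr0 powR0 ?gt_eqF//; apply/cvgr0Pnorm_lt => e e0.
apply: filterS (powR_norm_lt b0 e0) => z.
by rewrite (ger0_norm (powR_ge0 _ _)).
Qed.

(** The quotient equals |h|^(b - 1), which is even in [h]; hence the limit is the same infinity from
    both sides. *)
Lemma spow_slope_cvgy b : 0 < b < 1 ->
  (h^-1 * spow b h)%:E @[h --> (0 : R)^'] --> +oo%E.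
Proof.
move=> /andP[b0 b1]; apply/cvgeyPge => A.
(* Once |h|^(1 - b) is below this value, its inverse exceeds |A| + 1; the added 1 keeps the
   threshold positive when A = 0. *)
have A0 : 0 < (`|A| + 1)^-1 by rewrite invr_gt0 ltr_wpDl.
have b10 : 0 < 1 - b by rewrite subr_gt0.
have [d /= d0 hd] := powR_norm_lt b10 A0.
exists d => // h /= hd' h0; rewrite lee_fin.
have {}hd := hd h hd'.
have -> : h^-1 * spow b h = (`|h| `^ (1 - b))^-1.
  rewrite powRB ?normr_eq0 ?h0 ?implybT// powRr1// invf_div.
  rewrite /spow mulrA [RHS]mulrC; congr (_ * _).
  by rewrite -normfV normrEsg sgrV mulrC.
apply: (@le_trans _ _ (`|A| + 1)); first by rewrite (le_trans (ler_norm A))// lerDl.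
rewrite -[leLHS]invrK lef_pV2 ?posrE ?powR_gt0 ?normr_gt0//; exact: ltW.
Qed.



End signed_power.

Section directional_calculus.
Context {R : realType} {n : nat}.
Implicit Types (f : 'rV[R]_n -> R) (g : R -> R) (y e : 'rV[R]_n).

Lemma is_derive_dir_comp f g y e df dg :
  is_derive (f y) (1 : R) g dg -> is_derive y e f df ->
  is_derive y e (fun z => g (f z)) (dg * df).
Proof.
move=> hg hf; rewrite -[y]addr0 -(scale0r e).
apply/is_derive_lineP; apply: (is_derive1_comp (f := g)).
  by rewrite scale0r addr0.
by apply/is_derive_lineP; rewrite scale0r addr0.
Qed.

Lemma is_derive_coord y i j :
  is_derive y (basis_vec i) (fun z : 'rV[R]_n => z ord0 j) (i == j)%:R.
Proof.
rewrite -[y]addr0 -(scale0r (basis_vec i)); apply/is_derive_lineP.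
rewrite (_ : (fun s => _) =
    cst (y ord0 j) + (i == j)%:R \*: (id : R -> R)); last first.
  by apply/funext => s; rewrite !mxE eqxx/= !fctE mulrC eq_sym.
apply: is_derive_eq; rewrite add0r; exact: mulr1.
Qed.

End directional_calculus.

(** * Derivatives of the barrier, its flux and its drift *)

Section barrier.
Context {R : realType} {N : nat}.
Variables p gamma : 'I_N -> R.
Hypothesis hp : forall i, 1 < p i < 2.
Hypothesis gamma_gt0 : forall i, 0 < gamma i.
Implicit Types (y : 'rV[R]_N) (i : 'I_N).

Local Notation F := (barrier p gamma).
Local Notation m := (barrier_exp p).

Lemma p_gt1 i : 1 < p i. Proof. by have /andP[] := hp i. Qed.
Lemma p_lt2 i : p i < 2. Proof. by have /andP[] := hp i. Qed.

Lemma barrier_exp_gt1 i : 1 < m i.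
Proof.
have := p_gt1 i; have := p_lt2 i => p2 p1.
by rewrite /barrier_exp ltr_pdivlMr ?mul1r; lra.
Qed.

Lemma barrier_expB1 i : m i - 1 = 2 * (p i - 1) / (2 - p i).
Proof.
have := p_lt2 i => p2; rewrite /barrier_exp; field.
by rewrite gt_eqF// subr_gt0.
Qed.

Definition flux_exp i := (m i - 1) * (p i - 1).

Lemma flux_exp_gt0 i : 0 < flux_exp i.
Proof. by rewrite mulr_gt0// subr_gt0 ?barrier_exp_gt1 ?p_gt1. Qed.

(** The sign is decided by 2 (p_i - 1)^2 - (2 - p_i) = p_i (2 p_i - 3). *)
Lemma flux_exp_ge1 i : 3 / 2 <= p i -> 1 <= flux_exp i.
Proof.
move=> p32; have := p_lt2 i; rewrite -subr_gt0 => p2.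
rewrite /flux_exp barrier_expB1 mulrAC ler_pdivlMr//.
nra.
Qed.

Lemma flux_exp_lt1 i : p i < 3 / 2 -> flux_exp i < 1.
Proof.
move=> p32; have p1 := p_gt1 i; have := p_lt2 i; rewrite -subr_gt0 => p2.
rewrite /flux_exp barrier_expB1 mulrAC ltr_pdivrMr//.
nra.
Qed.

Lemma barrier_term_ge0 y i : 0 <= gamma i * `|y ord0 i| `^ m i.
Proof. by rewrite mulr_ge0 ?powR_ge0// ltW. Qed.

Lemma barrier_ge0 y : 0 <= F y.
Proof. by rewrite invr_ge0 sumr_ge0// => i _; exact: barrier_term_ge0. Qed.

Lemma barrier_term_le y i :
  gamma i * `|y ord0 i| `^ m i <= \sum_j gamma j * `|y ord0 j| `^ m j.
Proof.
rewrite (bigD1 i)//= lerDl sumr_ge0// => j _; exact: barrier_term_ge0.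
Qed.

Lemma barrier_gt0 y : y != 0 -> 0 < F y.
Proof.
move=> y0; have [i yi0] : exists i, y ord0 i != 0.
  apply/existsP; apply: contra_neqT y0 => /existsPn h.
  by apply/rowP => i; have := h i; rewrite negbK mxE => /eqP.
rewrite invr_gt0 (lt_le_trans _ (barrier_term_le y i))//.
by rewrite mulr_gt0// powR_gt0// normr_gt0.
Qed.

Lemma barrier_term_barrier_le1 y i : y != 0 ->
  gamma i * `|y ord0 i| `^ m i * F y <= 1.
Proof.
move=> y0; rewrite ler_pdivrMr ?mul1r ?barrier_term_le//.
by rewrite -invr_gt0 barrier_gt0.
Qed.

(** A total function, equal to the classical derivative away from the origin; it later serves as the
    weak gradient. *)
Definition barrier_grad i y :=
  - (F y ^+ 2 * (gamma i * (m i * spow (m i - 1) (y ord0 i)))).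

Lemma is_derive_barrier i y : y != 0 ->
  is_derive y (basis_vec i) F (barrier_grad i y).
Proof.
move=> y0.
have dPhi : is_derive y (basis_vec i)
    (fun z : 'rV[R]_N => \sum_j gamma j * `|z ord0 j| `^ m j)
    (gamma i * (m i * spow (m i - 1) (y ord0 i))).
  rewrite (_ : (fun z => _) = \sum_(j < N)
      (fun z : 'rV[R]_N => gamma j * `|z ord0 j| `^ m j)); last first.
    by apply/funext => z; rewrite fct_sumE.
  have -> : gamma i * (m i * spow (m i - 1) (y ord0 i)) = \sum_(j < N)
      (gamma j * (m j * spow (m j - 1) (y ord0 j)) * (i == j)%:R).
    rewrite (bigD1 i)//= eqxx mulr1 big1 ?addr0// => j ji.
    by rewrite eq_sym (negbTE ji) mulr0.
  apply: is_derive_sum => j.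
  apply: (is_derive_dir_comp (g := fun x => gamma j * `|x| `^ m j)
    (f := fun z : 'rV[R]_N => z ord0 j)); last exact: is_derive_coord.
  exact: (is_deriveZ _ (is_derive_normr_powR_gt1 _ (barrier_exp_gt1 j))).
have Phi0 : \sum_j gamma j * `|y ord0 j| `^ m j != 0.
  by rewrite -invr_eq0 gt_eqF// barrier_gt0.
have [dP dE] := dPhi; split; first exact: derivableV.
by rewrite /barrier deriveV// dE /barrier_grad /barrier exprVn scaleNr.
Qed.

Lemma derivable_barrier i y : y != 0 -> derivable F y (basis_vec i).
Proof. by move=> /(is_derive_barrier i)[]. Qed.

Lemma partial_barrier i y : y != 0 -> partial i F y = barrier_grad i y.
Proof. by move=> /(is_derive_barrier i)[]. Qed.

(** The nonpositive factor of the flux, differentiable off the origin in the direction of y_i. The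
    singular behaviour on {y_i = 0} is left entirely to the factor [spow]. *)
Definition flux_coef i y :=
  - ((gamma i * m i) `^ (p i - 1) * F y `^ (2 * (p i - 1))).

Lemma plap_flux_grad i y : plap_flux p i (barrier_grad i y) =
  flux_coef i y * spow (flux_exp i) (y ord0 i).
Proof.
rewrite /barrier_grad /flux_coef.
have [->|yi0] := eqVneq (y ord0 i) 0.
  by rewrite !spow0 !mulr0 oppr0 /plap_flux mulr0.
have m1 := barrier_exp_gt1 i; have p1 := p_gt1 i.
(* [X] is the absolute value of the gradient component. The sign is split off first, since real
   powers distribute over nonnegative factors only. *)
set X := F y ^+ 2 * ((gamma i * m i) * `|y ord0 i| `^ (m i - 1)).
have gm0 : 0 <= gamma i * m i by rewrite mulr_ge0 ?ltW// (lt_trans ltr01).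
have X0 : 0 <= X by rewrite mulr_ge0 ?exprn_ge0 ?barrier_ge0// mulr_ge0 ?powR_ge0.
have -> : F y ^+ 2 * (gamma i * (m i * spow (m i - 1) (y ord0 i))) =
    X * Num.sg (y ord0 i) by rewrite /X /spow; ring.
rewrite /plap_flux normrN normrM normr_sg yi0 mulr1 ger0_norm//.
rewrite mulrN mulrA [_ * X]mulrC.
have -> : p i - 2 = p i - 1 - 1 by ring.
rewrite mulr_powRB1 ?subr_gt0// /X powRM ?exprn_ge0 ?barrier_ge0//; last first.
  by rewrite mulr_ge0// powR_ge0.
rewrite powRM ?powR_ge0// -powRrM -(powR_mulrn _ (barrier_ge0 y)) -powRrM.
by rewrite /spow /flux_exp; ring.
Qed.

Lemma fluxE i y : y != 0 ->
  flux p i F y = flux_coef i y * spow (flux_exp i) (y ord0 i).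
Proof. by move=> y0; rewrite /flux partial_barrier// plap_flux_grad. Qed.

Definition flux_coef_grad i y := - ((gamma i * m i) `^ (p i - 1) *
  (2 * (p i - 1) * F y `^ (2 * (p i - 1) - 1) * barrier_grad i y)).

Lemma is_derive_flux_coef i y : y != 0 ->
  is_derive y (basis_vec i) (flux_coef i) (flux_coef_grad i y).
Proof.
move=> y0; apply: is_deriveN; apply: is_deriveZ.
apply: (is_derive_dir_comp (g := fun x => x `^ (2 * (p i - 1)))); last first.
  exact: is_derive_barrier.
by apply: is_derive1_powR; exact: barrier_gt0.
Qed.

(* The part of the i-th derivative of the flux that is continuous off the
   origin; the rest, [flux_coef] times the derivative of [spow], is nonpositive
   but infinite on {y_i = 0} if [p i < 3 / 2]. *)
Definition good_flux i y := flux_coef_grad i y * spow (flux_exp i) (y ord0 i).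

Lemma near_neq0 y : y != 0 -> \forall z \near y, z != 0.
Proof.
by apply: (@cvgr_neq0 _ _ _ (nbhs y) _ id y); exact: cvg_id.
Qed.

(** The product rule. At y_i = 0 the factor [spow] is differentiated at its origin, where exponent
    at least 1 is required. *)
Lemma is_derive_flux i y : y != 0 -> (y ord0 i = 0 -> 3 / 2 <= p i) ->
  is_derive y (basis_vec i) (flux p i F)
   (good_flux i y +
    flux_coef i y * (flux_exp i * `|y ord0 i| `^ (flux_exp i - 1))).
Proof.
move=> y0 yi.
apply: (@near_eq_is_derive _ _ _
  (fun z => flux_coef i z * spow (flux_exp i) (z ord0 i))).
  by apply: filterS (near_neq0 y0) => z /fluxE ->.
have ds : is_derive y (basis_vec i)
    (fun z : 'rV[R]_N => spow (flux_exp i) (z ord0 i))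
    (flux_exp i * `|y ord0 i| `^ (flux_exp i - 1)).
  have ds1 : is_derive (y ord0 i) (1 : R) (spow (flux_exp i))
      (flux_exp i * `|y ord0 i| `^ (flux_exp i - 1)).
    have [yi0|yi0] := eqVneq (y ord0 i) 0; last exact: is_derive_spow.
    by rewrite yi0; apply: is_derive_spow0; exact/flux_exp_ge1/yi.
  have := is_derive_dir_comp ds1 (is_derive_coord y i i).
  by rewrite eqxx mulr1.
have := is_deriveM (is_derive_flux_coef i y0) ds.
move=> h; apply: is_derive_eq; rewrite /good_flux addrC; congr (_ + _).
exact: mulrC.
Qed.

Lemma is_derive_drift i y : y != 0 ->
  is_derive y (basis_vec i) (drift i F) (F y + y ord0 i * barrier_grad i y).
Proof.
move=> y0; have := is_deriveM (is_derive_coord y i i) (is_derive_barrier i y0).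
rewrite eqxx => h; apply: is_derive_eq; rewrite addrC; congr (_ + _).
exact: mulr1.
Qed.

End barrier.

(** * The pointwise inequality *)

Section supersolution_inequality.
Context {R : realType} {N : nat}.
Variables p gamma : 'I_N -> R.
Hypothesis N_gt0 : (0 < N)%N.
Hypothesis hp : forall i, 1 < p i < 2.
Hypothesis hsum : \sum_i (p i)^-1 < (N%:R + 1) / 2.
Hypothesis gamma_gt0 : forall i, 0 < gamma i.
Implicit Types (y : 'rV[R]_N) (i j : 'I_N).

Local Notation F := (barrier p gamma).
Local Notation m := (barrier_exp p).
Local Notation S := (\sum_i (p i)^-1).

Let n0 : (0 : R) < N%:R. Proof. by rewrite ltr0n. Qed.

Lemma sum_invp_gt0 : 0 < S.
Proof.
rewrite (bigD1 (Ordinal N_gt0))//= ltr_pwDl//.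
  by rewrite invr_gt0 (lt_trans ltr01)// (p_gt1 hp).
by apply: sumr_ge0 => i _; rewrite invr_ge0 ltW// (lt_trans ltr01)// (p_gt1 hp).
Qed.

Lemma pbarE : pbar p = N%:R / S.
Proof. by rewrite /pbar invfM invrK. Qed.

Lemma alpha_gt0 : 0 < alpha p.
Proof.
have S0 := sum_invp_gt0.
rewrite /alpha divr_gt0// pbarE.
have -> : N%:R * (N%:R / S) - 2 * N%:R + N%:R / S =
    N%:R / S * (N%:R + 1 - 2 * S) by field; rewrite gt_eqF.
by rewrite mulr_gt0 ?divr_gt0// subr_gt0 mulrC -ltr_pdivlMr.
Qed.

Lemma sigmaE i : sigma p i = (p i)^-1 * ((N%:R + 1) / S) - 1.
Proof.
have S0 := sum_invp_gt0; rewrite /sigma pbarE; congr (_ * _ - 1).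
by field; rewrite !gt_eqF.
Qed.

Lemma sum_sigma : \sum_i sigma p i = 1.
Proof.
have S0 := sum_invp_gt0.
under eq_bigr do rewrite sigmaE.
rewrite big_split/= -mulr_suml sumrN sumr_const card_ord.
rewrite mulrCA divff ?gt_eqF// mulr1; ring.
Qed.

(** With c = (N + 1) / S the product is (c - p_i) / (2 - p_i), and c > 2 is the hypothesis on the
    sum. *)
Lemma sigma_barrier_exp_gt1 i : 1 < sigma p i * m i.
Proof.
have S0 := sum_invp_gt0; have p1 := p_gt1 hp i; have p2 := p_lt2 hp i.
have c2 : 2 < (N%:R + 1) / S by rewrite ltr_pdivlMr// mulrC -ltr_pdivlMr.
have -> : sigma p i * m i = ((N%:R + 1) / S - p i) / (2 - p i).
  rewrite sigmaE /barrier_exp; field.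
  by rewrite !gt_eqF//; lra.
by rewrite ltr_pdivlMr ?mul1r; lra.
Qed.

Definition min_ratio : R :=
  fine (\big[mine/+oo%E]_j (sigma p j * m j)%:E).

Lemma min_ratioP : 1 < min_ratio /\ forall j, min_ratio <= sigma p j * m j.
Proof.
rewrite /min_ratio; set M := (\big[mine/_]_j _)%E.
have M1 : (1%:E < M)%E.
  rewrite /M; apply: (big_ind (fun x => (1%:E < x)%E)); first exact: ltry.
    by move=> a b a1 b1; rewrite lt_min a1.
  by move=> j _; rewrite lte_fin sigma_barrier_exp_gt1.
have Mj j : (M <= (sigma p j * m j)%:E)%E.
  by rewrite /M (bigD1 j)//= ge_min lexx.
(* Without an index the minimum would be [+oo] and its [fine] a junk value; N > 0 supplies an index
   that bounds it. *)
have Mf : M \is a fin_num.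
  rewrite fin_numElt (lt_trans _ M1) ?ltNyr//=.
  by rewrite (le_lt_trans (Mj (Ordinal N_gt0)))// ltry.
by split=> [|j]; rewrite -?lte_fin -?lee_fin fineK.
Qed.

(** Since (m_i - 1) p_i = 2 (p_i - 1) m_i, this is gamma_i |y_i|^m_i F <= 1 raised to the power 2
    (p_i - 1). *)
Lemma powR_term_le i y : y != 0 ->
  `|y ord0 i| `^ ((m i - 1) * p i) <=
  (gamma i `^ (2 * (p i - 1)) * F y `^ (2 * (p i - 1)))^-1.
Proof.
move=> y0; have F0 := barrier_gt0 p gamma_gt0 y0; have F0' := ltW F0.
have p1 := p_gt1 hp i; have p2 := p_lt2 hp i.
have -> : (m i - 1) * p i = m i * (2 * (p i - 1)).
  by rewrite (barrier_expB1 hp) /barrier_exp; field; lra.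
have c0 : 0 < gamma i `^ (2 * (p i - 1)) * F y `^ (2 * (p i - 1)).
  by rewrite mulr_gt0 ?powR_gt0.
have g0' := ltW (gamma_gt0 i).
rewrite -[leRHS]mul1r ler_pdivlMr// powRrM -!powRM ?mulr_ge0 ?powR_ge0//.
apply: (@le_trans _ _ (1 `^ (2 * (p i - 1)))); last by rewrite powR1.
apply: ge0_ler_powR.
- by lra.
- by rewrite nnegrE mulr_ge0 ?powR_ge0// mulr_ge0.
- by rewrite nnegrE.
rewrite mulrA [_ * gamma i]mulrC; exact: barrier_term_barrier_le1.
Qed.

Lemma norm_barrier_grad i y : `|barrier_grad p gamma i y| <=
  F y ^+ 2 * (gamma i * m i * `|y ord0 i| `^ (m i - 1)).
Proof.
have m0 : 0 < m i by rewrite (lt_trans ltr01)// (barrier_exp_gt1 hp).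
have F0 : 0 <= F y ^+ 2 by rewrite exprn_ge0// barrier_ge0.
rewrite /barrier_grad normrN normrM ger0_norm//; apply: ler_wpM2l => //.
rewrite 2!normrM (gtr0_norm (gamma_gt0 i)) (gtr0_norm m0) -mulrA.
by rewrite !ler_pM2l// norm_spow.
Qed.

(** The gradient contributes F^(2 p_i), and trading |y_i| for F costs F^(- 2 (p_i - 1)); what is
    left is F^2. *)
Lemma powR_barrier_grad_le i y : y != 0 ->
  `|barrier_grad p gamma i y| `^ p i <=
  (gamma i * m i) `^ p i * (gamma i `^ (2 * (p i - 1)))^-1 * F y ^+ 2.
Proof.
move=> y0; have F0 := barrier_gt0 p gamma_gt0 y0; have F0' := ltW F0.
have p1 := p_gt1 hp i; have p2 := p_lt2 hp i.
have m0 : 0 < m i by rewrite (lt_trans ltr01)// (barrier_exp_gt1 hp).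
have g0' := ltW (gamma_gt0 i); have m0' := ltW m0.
have gm0 : 0 <= gamma i * m i by rewrite mulr_ge0.
apply: (@le_trans _ _ ((F y ^+ 2 * (gamma i * m i *
    `|y ord0 i| `^ (m i - 1))) `^ p i)).
  apply: ge0_ler_powR; rewrite ?nnegrE ?norm_barrier_grad//; first lra.
  by rewrite mulr_ge0 ?exprn_ge0 ?barrier_ge0// mulr_ge0 ?powR_ge0.
have w0 : 0 <= gamma i * m i * `|y ord0 i| `^ (m i - 1).
  by apply: mulr_ge0 => //; exact: powR_ge0.
rewrite powRM ?exprn_ge0//.
rewrite powRM ?powR_ge0// -powRrM -(powR_mulrn _ F0') -powRrM.
rewrite mulrCA -mulrA ler_wpM2l ?powR_ge0//.
apply: le_trans (ler_wpM2l (powR_ge0 _ _) (powR_term_le i y0)) _.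
rewrite invfM mulrCA ler_wpM2l ?invr_ge0 ?powR_ge0//.
rewrite -powRN -powRD ?(gt_eqF F0) ?implybT//.
by rewrite le_eqVlt; apply/orP; left; apply/eqP; congr (_ `^ _); ring.
Qed.

Hypothesis hgamma : forall i, gamma i <= gamma_bound p i.

Lemma powR_gamma_le i : gamma i `^ (2 - p i) <=
  alpha p / N%:R * (min_ratio - 1) * (2 * (p i - 1))^-1 * m i `^ (- p i).
Proof.
have p1 := p_gt1 hp i; have p2 := p_lt2 hp i.
have [M1 _] := min_ratioP; have a0 := alpha_gt0.
have := hgamma i; rewrite /gamma_bound -/min_ratio; set B := (X in X `^ _).
(* Raising to the power 2 - p_i undoes the outer exponent of the bound because its base is
   nonnegative. *)
have B0 : 0 <= B.
  rewrite /B mulr_ge0 ?powR_ge0// mulr_ge0 ?invr_ge0//; last lra.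
  apply: mulr_ge0; last by rewrite subr_ge0 ltW.
  by apply: divr_ge0; [exact: ltW|exact: ler0n].
have p20 : 0 < 2 - p i by lra.
have E : B = (B `^ (2 - p i)^-1) `^ (2 - p i).
  by rewrite -powRrM mulVf ?powRr1// lt0r_neq0.
move=> h; rewrite [leRHS]E.
by apply: ge0_ler_powR; rewrite ?nnegrE ?powR_ge0//; exact: ltW.
Qed.

(** The powers collapse: F^(2 p_i - 1) F^(- 2 (p_i - 1)) = F and gamma_i^p_i gamma_i^(- 2 (p_i - 1))
    = gamma_i^(2 - p_i). The remaining factors are the ones that the bound on gamma_i cancels. *)
Lemma good_flux_le i y : y != 0 ->
  good_flux p gamma i y <= alpha p / N%:R * (min_ratio - 1) * F y.
Proof.
move=> y0; have F0 := barrier_gt0 p gamma_gt0 y0; have F0' := ltW F0.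
have p1 := p_gt1 hp i; have p2 := p_lt2 hp i.
have m0 : 0 < m i by rewrite (lt_trans ltr01)// (barrier_exp_gt1 hp).
have gm0 : 0 < gamma i * m i by rewrite mulr_gt0.
have -> : good_flux p gamma i y = 2 * (p i - 1) *
    ((gamma i * m i) `^ (p i - 1) * (gamma i * m i)) *
    (F y `^ (2 * (p i - 1) - 1) * F y ^+ 2) *
    (spow (m i - 1) (y ord0 i) * spow (flux_exp p i) (y ord0 i)).
  by rewrite /good_flux /flux_coef_grad /barrier_grad; ring.
rewrite spowM [_ * (gamma i * m i)]mulrC (mulr_powRB1 (ltW gm0) (lt_trans ltr01 p1)).
have -> : m i - 1 + flux_exp p i = (m i - 1) * p i by rewrite /flux_exp; ring.
rewrite -(powR_mulrn _ (ltW F0)) -powRD ?(gt_eqF F0) ?implybT//.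
have -> : 2 * (p i - 1) - 1 + 2%:R = 2 * (p i - 1) + 1 by ring.
apply: (@le_trans _ _ (2 * (p i - 1) * (gamma i * m i) `^ p i *
    F y `^ (2 * (p i - 1) + 1) *
    (gamma i `^ (2 * (p i - 1)) * F y `^ (2 * (p i - 1)))^-1)).
  apply: ler_wpM2l; first by rewrite !mulr_ge0 ?powR_ge0//; lra.
  apply: le_trans (powR_term_le i y0).
  by case: (y ord0 i != 0); rewrite ?mul1r// mul0r powR_ge0.
rewrite powRD ?(gt_eqF F0) ?implybT// powRr1//.
set c := F y `^ (2 * (p i - 1)).
have c0 : c != 0 by rewrite gt_eqF ?powR_gt0.
have g0 : gamma i `^ (2 * (p i - 1)) != 0 by rewrite gt_eqF ?powR_gt0.
have -> : 2 * (p i - 1) * (gamma i * m i) `^ p i * (c * F y) *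
     (gamma i `^ (2 * (p i - 1)) * c)^-1 =
   2 * (p i - 1) * m i `^ p i * gamma i `^ (2 - p i) * F y.
  rewrite powRM ?(ltW (gamma_gt0 i)) ?(ltW m0)//.
  have -> : gamma i `^ (2 - p i) = gamma i `^ p i / gamma i `^ (2 * (p i - 1)).
    by rewrite -powRB ?(gt_eqF (gamma_gt0 i)) ?implybT//; congr (_ `^ _); ring.
  by field; rewrite c0 g0.
rewrite ler_pM2r//.
apply: le_trans (ler_wpM2l _ (powR_gamma_le i)) _.
  by rewrite mulr_ge0 ?powR_ge0//; lra.
rewrite le_eqVlt; apply/orP; left; apply/eqP.
have mp0 : m i `^ p i != 0 by rewrite gt_eqF ?powR_gt0.
rewrite powRN; field; rewrite mp0 gt_eqF//=; lra.
Qed.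

Lemma mul_barrier_grad i y : y ord0 i * barrier_grad p gamma i y =
  - (F y ^+ 2 * (m i * (gamma i * `|y ord0 i| `^ m i))).
Proof.
rewrite -(@mul_spow _ (m i)) ?(lt_trans ltr01) ?(barrier_exp_gt1 hp)//.
by rewrite /barrier_grad; ring.
Qed.

Lemma sum_good_flux_drift_le0 y : y != 0 ->
  \sum_i (good_flux p gamma i y + alpha p * sigma p i *
          (F y + y ord0 i * barrier_grad p gamma i y)) <= 0.
Proof.
move=> y0; have F0 := barrier_gt0 p gamma_gt0 y0; have F0' := ltW F0.
have a0 := alpha_gt0.
have [_ Mj] := min_ratioP.
have FE : F y * \sum_i gamma i * `|y ord0 i| `^ m i = 1.
  by rewrite mulVf// -invr_eq0 gt_eqF.
apply: (@le_trans _ _ (\sum_i (alpha p / N%:R * (min_ratio - 1) * F y +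
    (alpha p * F y * sigma p i -
     alpha p * F y ^+ 2 * min_ratio * (gamma i * `|y ord0 i| `^ m i))))).
  apply: ler_sum => i _; apply: lerD; first exact: good_flux_le.
  rewrite mul_barrier_grad mulrDr; apply: lerD.
    by rewrite le_eqVlt; apply/orP; left; apply/eqP; ring.
  rewrite mulrN lerN2.
  have -> : alpha p * sigma p i * (F y ^+ 2 * (m i * (gamma i * `|y ord0 i| `^ m i)))
    = alpha p * F y ^+ 2 * (sigma p i * m i) * (gamma i * `|y ord0 i| `^ m i).
    by ring.
  apply: ler_wpM2r; first exact: barrier_term_ge0.
  apply: ler_wpM2l (Mj i).
  by apply: mulr_ge0; [exact: ltW|exact: exprn_ge0].
rewrite big_split/= sumr_const card_ord big_split/= -mulr_sumr sum_sigma.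
rewrite sumrN -mulr_sumr.
have -> : alpha p * F y ^+ 2 * min_ratio * (\sum_i gamma i * `|y ord0 i| `^ m i) =
   alpha p * F y * min_ratio * (F y * \sum_i gamma i * `|y ord0 i| `^ m i).
  by ring.
(* The majorant is exactly 0: the N shares alpha / N (min - 1) F of the flux add up to what the
   drift takes away. *)
rewrite FE -mulr_natr le_eqVlt; apply/orP; left; apply/eqP.
by field; rewrite gt_eqF.
Qed.

End supersolution_inequality.

(** * Integrability at infinity *)

Section integrability.
Context {R : realType}.

(** The integrand is even, and on the half-line it has the antiderivative (1 + x)^(1 - s) / (1 - s),
    which vanishes at infinity. *)
Lemma integral_tail_lty (s : R) : 1 < s ->
  (\int[lebesgue_measure]_x ((1 + `|x : R|) `^ (- s))%:E < +oo)%E.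
Proof.
move=> s1; pose f (x : R) := (1 + `|x|) `^ (- s).
have s10 : 1 - s != 0 by rewrite lt_eqF// subr_lt0.
have f0 x : 0 <= f x by exact: powR_ge0.
have cf : continuous f.
  move=> x; have x0 : 0 < 1 + `|x| by rewrite ltr_pwDl.
  have [/derivable1_diffP/differentiable_continuous c _] :=
    is_derive1_powR (- s) x0.
  apply: (@continuous_comp _ _ _ (fun x : R => 1 + `|x|)
    (fun z => z `^ (- s))) => //.
  by apply: continuousD; [exact: cvg_cst|exact: norm_continuous].
have mf : measurable_fun setT (f : measurableTypeR R -> R).
  exact: continuous_measurable_fun.
have dF (x : R) : 0 < 1 + x -> is_derive x (1 : R)
    (fun x => (1 - s)^-1 * (1 + x) `^ (1 - s)) ((1 + x) `^ (- s)).
  move=> x1; have d1 : is_derive x (1 : R) (fun x : R => 1 + x) 1.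
    have := is_deriveD (is_derive_cst (1 : R) x (1 : R)) (is_derive_id x (1 : R)).
    by rewrite add0r.
  have d2 := is_derive1_comp (f := fun z => z `^ (1 - s)) (is_derive1_powR _ x1) d1.
  have := is_deriveZ (1 - s)^-1 d2; move=> d3; apply: is_derive_eq.
  rewrite mulr1 [_ *: _]mulrA mulVf// mul1r; congr (_ `^ _); ring.
have half : (\int[lebesgue_measure]_(x in `[0%R, +oo[) (f x)%:E < +oo)%E.
  rewrite (@ge0_continuous_FTC2y R f
    (fun x => (1 - s)^-1 * (1 + x) `^ (1 - s)) 0 0)//.
  - exact: ltry.
  - exact: continuous_subspaceT.
  - rewrite -[X in _ --> X](mulr0 (1 - s)^-1); apply: cvgM; first exact: cvg_cst.
    apply/cvgr0Pnorm_lt => e e0; near=> x.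
    have x0 : 0 < x by near: x; exact/nbhs_pinfty_gt/num_real.
    have x1 : 0 < 1 + x by rewrite addr_gt0.
    rewrite (ger0_norm (powR_ge0 _ _)) -opprB powRN.
    rewrite -[ltRHS]invrK ltf_pV2 ?posrE ?invr_gt0 ?powR_gt0//.
    have s0 : 0 < s - 1 by rewrite subr_gt0.
    have E : e^-1 = (e^-1 `^ (s - 1)^-1) `^ (s - 1).
      by rewrite -powRrM mulVf ?powRr1 ?invr_ge0 ?ltW// lt0r_neq0.
    rewrite E; apply: gt0_ltr_powR; rewrite ?nnegrE ?powR_ge0//; first exact: ltW.
    rewrite -ltrBlDl; near: x; exact/nbhs_pinfty_gt/num_real.
  - move=> x x0; have x1 : 0 < 1 + x by rewrite addr_gt0.
    have [d _] := dF x x1; exact: d.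
  - apply: cvg_at_right_filter.
    have [/derivable1_diffP/differentiable_continuous d _] :=
      dF 0 (ltr_pwDl ltr01 (lexx 0)).
    exact: d.
  - move=> x; rewrite in_itv/= andbT => x0.
    have x1 : 0 < 1 + x by rewrite addr_gt0.
    by have [_ e] := dF x x1; rewrite derive1E e /f gtr0_norm.
rewrite ge0_symfun_integralT//; last by move=> x; rewrite /f/= normrN.
by rewrite -set_itvcy lte_mul_pinfty.
Unshelve. all: by end_near. Qed.

End integrability.

(** * Bounds and integrability of the barrier outside a ball *)

Section barrier_integrability.
Context {R : realType} {N : nat}.
Variables p gamma : 'I_N -> R.
Hypothesis N_gt0 : (0 < N)%N.
Hypothesis hp : forall i, 1 < p i < 2.
Hypothesis hsum : \sum_i (p i)^-1 < (N%:R + 1) / 2.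
Hypothesis gamma_gt0 : forall i, 0 < gamma i.
Implicit Types (y : 'rV[R]_N) (i j : 'I_N).

Local Notation F := (barrier p gamma).
Local Notation m := (barrier_exp p).
Local Notation Phi y := (\sum_i gamma i * `|y ord0 i| `^ m i).

Let n0 : (0 : R) < N%:R. Proof. by rewrite ltr0n. Qed.

(** Passage from the Euclidean norm to a single large coordinate. The constant r / N is not sharp,
    but N (r / N)^2 <= r^2 suffices. *)
Lemma enorm_coord_ge (r : R) y : 0 < r -> r <= enorm y ->
  exists i, r / N%:R <= `|y ord0 i|.
Proof.
move=> r0 ry; apply/existsP; apply: contraTT ry => /existsPn h.
have rE : r = Num.sqrt (r ^+ 2) by rewrite sqrtr_sqr gtr0_norm.
rewrite -ltNge /enorm rE ltr_sqrt ?exprn_gt0//.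
have rN0 : 0 <= r / N%:R by rewrite divr_ge0 ?ltW.
have n1 : 1 <= N%:R :> R by rewrite ler1n.
apply: (@lt_le_trans _ _ (\sum_(i < N) (r / N%:R) ^+ 2)).
  apply: ltr_sum.
    by apply/hasP; exists (Ordinal N_gt0); rewrite ?mem_index_enum.
  move=> i _; rewrite -real_normK ?num_real//.
  by rewrite ltr_pXn2r// ?nnegrE// ltNge h.
rewrite sumr_const card_ord expr_div_n -[_ *+ N]mulr_natr -mulrA.
rewrite ler_piMr ?sqr_ge0// mulrC expr2 invfM mulrA divff ?gt_eqF// mul1r.
by rewrite invf_le1.
Qed.

Lemma enorm_neq0 (r : R) y : 0 < r -> r <= enorm y -> y != 0.
Proof.
move=> r0 /(enorm_coord_ge r0)[i]; apply: contraTneq => ->.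
by rewrite mxE normr0 -ltNge divr_gt0.
Qed.

Lemma barrier_bounded (r : R) : 0 < r ->
  exists2 c, 0 < c & forall y, r <= enorm y -> F y <= c.
Proof.
move=> r0; have rN0 : 0 < r / N%:R by rewrite divr_gt0.
have t0 i : 0 < gamma i * (r / N%:R) `^ m i by rewrite mulr_gt0// powR_gt0.
(* The index of the large coordinate depends on [y]; the sum dominates the bound for every index. *)
exists (\sum_i (gamma i * (r / N%:R) `^ m i)^-1).
  rewrite (bigD1 (Ordinal N_gt0))//= ltr_pwDl ?invr_gt0//.
  by apply: sumr_ge0 => i _; rewrite invr_ge0 ltW.
move=> y ry; have y0 := enorm_neq0 r0 ry.
have [i yi] := enorm_coord_ge r0 ry.
apply: (@le_trans _ _ ((gamma i * (r / N%:R) `^ m i)^-1)).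
  rewrite lef_pV2 ?posrE//; last by rewrite -invr_gt0 (barrier_gt0 p gamma_gt0 y0).
  apply: le_trans (barrier_term_le p gamma_gt0 y i).
  have m0 := lt_trans ltr01 (barrier_exp_gt1 hp i).
  by rewrite ler_pM2l//; apply: ge0_ler_powR; rewrite ?nnegrE//; exact: ltW.
rewrite (bigD1 i)//= lerDl; apply: sumr_ge0 => j _; rewrite invr_ge0 ltW//.
Qed.

Lemma sum_inv_barrier_exp : \sum_i (m i)^-1 < 1.
Proof.
have -> : \sum_i (m i)^-1 = \sum_i (2 * (p i)^-1 - 1).
  apply: eq_bigr => i _; have := p_gt1 hp i; have := p_lt2 hp i => p2 p1.
  by rewrite /barrier_exp; field; lra.
rewrite big_split/= -mulr_sumr sumrN sumr_const card_ord.
by rewrite ltrBlDr addrC -ltr_pdivlMl// mulrC.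
Qed.

(* Weights of total mass 1 with [m i * theta i > 1], which exist because the
   sum of the [(m i)^-1] is less than 1: writing [1 / F] as the product of its
   powers [theta i] bounds [F] by a product of integrable functions of one
   variable. *)
Let theta i := (m i)^-1 + (1 - \sum_j (m j)^-1) / N%:R.

Let sum_theta : \sum_i theta i = 1.
Proof.
rewrite big_split/= sumr_const card_ord -[_ *+ N]mulr_natr divfK ?gt_eqF//.
by rewrite addrC subrK.
Qed.

Definition tail_exp i := m i * theta i.

Lemma tail_exp_gt1 i : 1 < tail_exp i.
Proof.
have m0 : 0 < m i by apply: lt_trans (barrier_exp_gt1 hp i).
rewrite /tail_exp mulrDr mulfV ?gt_eqF// ltrDl mulr_gt0// divr_gt0//.
by rewrite subr_gt0 sum_inv_barrier_exp.
Qed.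

Lemma barrier_le_prod (r : R) : 0 < r -> exists2 C, 0 < C &
  forall y, r <= enorm y ->
  F y <= C * \prod_i (1 + `|y ord0 i|) `^ (- tail_exp i).
Proof.
move=> r0; have [c c0 Fc] := barrier_bounded r0.
(* Chosen so that k_i (1 + |y_i|)^m_i <= 1 / F. For |y_i| <= 1 the base is at most 2 and 1 / F >= 1
   / c; for |y_i| > 1 it is at most 2 |y_i| and the i-th term of 1 / F takes over. *)
pose k i := Num.min c^-1 (gamma i) / 2 `^ m i.
have k0 i : 0 < k i by rewrite divr_gt0 ?powR_gt0// lt_min invr_gt0 c0/=.
exists ((\prod_i k i `^ theta i)^-1).
  by rewrite invr_gt0 prodr_gt0// => i _; rewrite powR_gt0.
move=> y ry; have y0 := enorm_neq0 r0 ry.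
have F0 := barrier_gt0 p gamma_gt0 y0.
have P0 : 0 < Phi y by rewrite -invr_gt0.
have Pc : c^-1 <= Phi y by rewrite -[leRHS]invrK lef_pV2 ?posrE// Fc.
have y1 i : 0 < 1 + `|y ord0 i| by rewrite ltr_pwDl.
have m0 i : 0 < m i by apply: lt_trans (barrier_exp_gt1 hp i).
have m0' i := ltW (m0 i).
have kP i : k i * (1 + `|y ord0 i|) `^ m i <= Phi y.
  have [yi1|yi1] := leP `|y ord0 i| 1.
    apply: le_trans Pc; apply: (@le_trans _ _ (k i * 2 `^ m i)).
      rewrite ler_pM2l//; apply: ge0_ler_powR; rewrite ?nnegrE ?addr_ge0//.
      by lra.
    by rewrite /k divfK ?gt_eqF ?powR_gt0// ge_min lexx.
  apply: le_trans (barrier_term_le p gamma_gt0 y i).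
  apply: (@le_trans _ _ (k i * (2 * `|y ord0 i|) `^ m i)).
    rewrite ler_pM2l//; apply: ge0_ler_powR; rewrite ?nnegrE ?addr_ge0//; lra.
  rewrite powRM// mulrA /k divfK ?gt_eqF ?powR_gt0//.
  by apply: ler_wpM2r; rewrite ?powR_ge0// ge_min lexx orbT.
rewrite /barrier -[leRHS]invrK lef_pV2 ?posrE//; last first.
  rewrite invr_gt0 mulr_gt0 ?invr_gt0 ?prodr_gt0// => i _; exact: powR_gt0.
rewrite invfM invrK.
have -> : Phi y = \prod_i Phi y `^ theta i.
  transitivity (Phi y `^ (\sum_i theta i)).
    by rewrite sum_theta powRr1 ?(ltW P0).
  have pD : {morph powR (Phi y) : a b / a + b >-> a * b}.
    by move=> a b; rewrite powRD// (gt_eqF P0) implybT.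
  exact: (big_morph _ pD (powRr0 _)).
rewrite -prodfV -big_split/=; apply: ler_prod => i _.
rewrite powRN invrK mulr_ge0 ?powR_ge0//= /tail_exp powRrM.
rewrite -powRM ?powR_ge0 ?(ltW (k0 i))//.
apply: ge0_ler_powR; rewrite ?nnegrE ?(ltW P0)//.
- rewrite /theta addr_ge0 ?invr_ge0 ?(ltW (m0 i))// divr_ge0// ltW// subr_gt0.
  exact: sum_inv_barrier_exp.
- by rewrite mulr_ge0 ?powR_ge0// ltW.
Qed.

Lemma measurable_barrier : measurable_fun setT F.
Proof.
(* The inverse is rewritten as a real power, whose measurability holds on the whole line, 0
   included. *)
rewrite (_ : F = (fun z => z `^ (-1)) \o (fun y => Phi y)); last first.
  apply/funext => y /=; rewrite powR_inv1//.
  by apply: sumr_ge0 => i _; exact: barrier_term_ge0.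
apply: (measurableT_comp (measurable_powR _)).
apply: measurable_sum => i; apply: measurable_funM => //.
apply: (measurableT_comp (measurable_powR _)).
by apply: measurableT_comp => //; exact: measurable_rV_coord.
Qed.

Lemma measurable_enorm : measurable_fun setT (@enorm R N).
Proof.
apply: (@measurableT_comp _ _ _ _ _ _ (@Num.sqrt R)).
  by apply: continuous_measurable_fun; exact: sqrt_continuous.
apply: measurable_sum => i; apply: measurable_funX; exact: measurable_rV_coord.
Qed.

Lemma measurable_eballC (r : R) : measurable (~` eball r : set 'rV[R]_N).
Proof.
apply: measurableC; rewrite (_ : eball r = enorm @^-1` `]-oo, r[%classic).
  by rewrite -[X in measurable X]setTI; apply: measurable_enorm.
by apply/seteqP; split => y; rewrite /eball/= in_itv.
Qed.

Lemma integrable_barrier (r : R) : 0 < r ->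
  (lebesgue_rV N).-integrable (~` eball r) (EFin \o F).
Proof.
move=> r0; have [C C0 FC] := barrier_le_prod r0.
pose g i (x : measurableTypeR R) : R := (1 + `|x|) `^ (- tail_exp i).
have mg i : measurable_fun setT (g i).
  apply: (measurableT_comp (measurable_powR _)).
  by apply: measurable_funD => //; exact: measurableT_comp.
have g0 i x : 0 <= g i x by exact: powR_ge0.
have mball := measurable_eballC r.
have mP : measurable_fun setT (fun y : 'rV[R]_N => \prod_i g i (y ord0 i)).
  apply: measurable_prod => i _.
  exact: (measurableT_comp (mg i) (@measurable_rV_coord R N i)).
have iP : (lebesgue_rV N).-integrable setT
    (EFin \o (fun y : 'rV[R]_N => \prod_i g i (y ord0 i))).
  apply/integrableP; split; first exact/measurable_EFinP.
  under eq_integral do rewrite /= ger0_norm ?prodr_ge0//.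
  rewrite ge0_integral_rV_prod// ltey_eq; apply/orP; left.
  apply: prode_fin_num => i _; rewrite ge0_fin_numE.
    exact/integral_tail_lty/tail_exp_gt1.
  by apply: integral_ge0 => x _; rewrite lee_fin.
apply: (@le_integrable _ _ _ _ _ mball _
  (EFin \o (fun y : 'rV[R]_N => C * \prod_i g i (y ord0 i)))).
- by apply/measurable_EFinP; apply: measurable_funTS; exact: measurable_barrier.
- move=> y /= /negP; rewrite -leNgt => ry.
  rewrite lee_fin ger0_norm ?barrier_ge0//.
  by rewrite (le_trans (FC _ ry))// ler_norm.
- apply: (@integrableS _ _ _ _ setT) => //.
  exact: (integrableZl measurableT C iP).
Qed.

End barrier_integrability.

(** * Supersolution properties *)

Section bounds_off_the_origin.
Context {R : realType} {n : nat}.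
Implicit Types (f u s : 'rV[R]_n -> R) (i : 'I_n) (K Omega : set 'rV[R]_n).

Lemma compact_continuous_bounded K f : compact K ->
  (forall y, K y -> {for y, continuous f}) ->
  exists2 C, 0 <= C & forall y, K y -> `|f y| <= C.
Proof.
move=> cK cf; have /compact_bounded[C [_ hC]] : compact (f @` K).
  apply: continuous_compact => //; apply: continuous_in_subspaceT => y.
  by rewrite inE => /cf.
exists (`|C| + 1) => [|y Ky]; first by rewrite addr_ge0.
apply: hC; last by exists y.
by rewrite (le_lt_trans (ler_norm C))// ltrDl.
Qed.

Lemma compact_measurable_rV K : compact K -> measurable K.
Proof.
move=> /(compact_closed (@norm_hausdorff _ _)) cK.
rewrite -[K]setCK; apply: measurableC; apply: open_measurable_rV.
exact: closed_openC.
Qed.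

Lemma locally_bounded_loc_integrable Omega f : open Omega ->
  locally_bounded (f \_ Omega) -> loc_integrable Omega f.
Proof.
move=> oO [mf bf]; have mO := open_measurable_rV oO.
have mfO : measurable_fun Omega f.
  by apply/(measurable_restrictT f mO).
split => // K KO cK; have [M KM] := compact_sub_rV_cube cK.
have mK := compact_measurable_rV cK; have [C hC] := bf M.
apply: measurable_bounded_integrable => //.
- apply: le_lt_trans (lebesgue_rV_cube_lty M).
  by apply: le_measure; rewrite ?inE//; exact: measurable_rV_cube.
- exact: measurable_funS mfO.
- exists `|C|; split; first exact: num_real.
  move=> x Cx y /= Ky; have := hC y (KM _ Ky).
  rewrite patchE mem_set//; last exact: KO.
  move=> /le_trans; apply; rewrite (le_trans (ler_norm C))// ltW//.
Qed.

(** [Omega] is not closed, but its part in a cube lies in the cube minus a small open ball of the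
    sup norm, which is compact and avoids the origin. *)
Lemma continuous_off0_locally_bounded (r : R) Omega f : (0 < n)%N -> 0 < r ->
  open Omega -> Omega `<=` [set y | r <= enorm y] ->
  (forall y, y != 0 -> {for y, continuous f}) -> locally_bounded (f \_ Omega).
Proof.
move=> n0 r0 oO Or cf; have rn0 : 0 < r / n%:R by rewrite divr_gt0// ltr0n.
split.
  apply/(measurable_restrictT f (open_measurable_rV oO)).
  apply: continuous_measurable_rV => // y Oy; apply: cf.
  exact: (enorm_neq0 n0 r0 (Or _ Oy)).
move=> M; pose B := rV_cube M `&` [set y : 'rV[R]_n | r / n%:R <= `|y|].
have cB : compact B.
  apply: compact_closedI; first exact: compact_rV_cube.
  apply: (@closed_comp _ _ (fun y : 'rV[R]_n => `|y|) [set x | r / n%:R <= x]).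
    by move=> y _; exact: norm_continuous.
  exact: closed_ge.
have [|C C0 hC] := compact_continuous_bounded (f := f) cB.
  by move=> y [_ /= ry]; apply: cf; rewrite -normr_gt0 (lt_le_trans rn0).
exists C => y yM; rewrite patchE; case: ifPn => [|_]; last by rewrite normr0.
rewrite inE => Oy; apply: hC; split => //=.
have [i yi] := enorm_coord_ge n0 r0 (Or _ Oy).
exact: le_trans (rV_coord_le_norm i y).
Qed.

(* No derivative of [s] is involved: the increment of [s] is multiplied by
   [u <= 0] and can be dropped. *)
Lemma monotone_product_quotient K Omega i u u' s (eps : R) :
  open Omega -> compact K -> K `<=` Omega ->
  (forall y, Omega y -> is_derive y (basis_vec i) u (u' y)) ->
  (forall y, Omega y -> {for y, continuous u'}) ->
  (forall y, Omega y -> {for y, continuous s}) ->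
  (forall y, Omega y -> u y <= 0) ->
  (forall h y, 0 < h -> s (y - h *: basis_vec i) <= s y) -> 0 < eps ->
  exists2 d, 0 < d & forall h y, 0 < h < d -> K y ->
    u y * s y - u (y - h *: basis_vec i) * s (y - h *: basis_vec i) <=
    h * (u' y * s y + eps).
Proof.
move=> oO cK KO du cu' cs u0 smono e0.
have [C1 C10 hC1] := compact_continuous_bounded cK (fun y Ky => cu' y (KO _ Ky)).
have [C2 C20 hC2] := compact_continuous_bounded cK (fun y Ky => cs y (KO _ Ky)).
(* The errors are eta (C2 + 1), from the increment of [u'], and C1 eta, from that of [s]. The cap at
   1 ensures |s| <= C2 + 1 at the translated point. *)
pose eta := Num.min 1 (eps / (C1 + C2 + 1)).
have C0 : 0 < C1 + C2 + 1 by rewrite ltr_wpDl// addr_ge0.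
have eta0 : 0 < eta by rewrite lt_min ltr01 divr_gt0.
have eta1 : eta <= 1 by rewrite ge_min lexx.
have etae : eta * (C1 + C2 + 1) <= eps by rewrite -ler_pdivlMr// ge_min lexx orbT.
have [d1 d10 h1] := near_line (basis_vec i) oO cK KO cu' eta0.
have [d2 d20 h2] := near_line (basis_vec i) oO cK KO cs eta0.
exists (Num.min d1 d2); first by rewrite lt_min d10.
move=> h y /andP[h0]; rewrite lt_min => /andP[hd1 hd2] Ky.
have sh t : y - h *: basis_vec i + t *: basis_vec i =
    y + (t - h) *: basis_vec i by rewrite scalerBl addrAC addrA.
have Oh t : 0 <= t <= h -> `|t - h| < d1.
  move=> /andP[t0 th]; rewrite ler0_norm ?subr_le0// (le_lt_trans _ hd1)//.
  by rewrite opprB gerBl.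
have [t th|c ch] := MVT_line (f := u) (y := y - h *: basis_vec i)
    (e := basis_vec i) h0.
  by rewrite sh; have [Ot _] := h1 _ _ (Oh _ th) Ky; have [] := du _ Ot.
rewrite !sh subrr scale0r addr0 => uE.
have [Oc u'c] := h1 _ _ (Oh _ ch) Ky.
have [_ sy] : Omega (y + - h *: basis_vec i) /\
    `|s (y + - h *: basis_vec i) - s y| < eta.
  by apply: h2 => //; rewrite normrN gtr0_norm.
rewrite scaleNr in sy.
have {}uE : u y - u (y - h *: basis_vec i) = h * u' (y + (c - h) *: basis_vec i).
  by rewrite uE; have [_ ->] := du _ Oc.
set z := y - h *: basis_vec i in uE sy *.
set v := u' _ in uE u'c.
have sz := smono h y h0; rewrite -/z in sz.
have uy := u0 _ (KO _ Ky).
apply: (@le_trans _ _ (h * (v * s z))).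
  have -> : u y * s y - u z * s z = u y * (s y - s z) + (u y - u z) * s z by ring.
  by rewrite uE -mulrA gerDr mulr_le0_ge0// subr_ge0.
rewrite ler_pM2l// -lerBlDl.
have -> : v * s z - u' y * s y = (v - u' y) * s z + u' y * (s z - s y) by ring.
apply: le_trans etae; rewrite (le_trans (ler_norm _))//.
rewrite (le_trans (ler_normD _ _))// !normrM.
have sz2 : `|s z| <= C2 + 1.
  rewrite -[s z](subrK (s y)) (le_trans (ler_normD _ _))// addrC lerD ?hC2//.
  by rewrite ltW// (lt_le_trans sy).
rewrite mulrDr addrC mulrDr -addrA -mulrDr.
have -> : eta * C1 + (eta * (C2 + 1)) = C1 * eta + eta * (C2 + 1) by ring.
apply: lerD; first by apply: ler_pM => //; [exact: hC1|exact: ltW].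
by apply: ler_pM => //; exact: ltW.
Qed.

End bounds_off_the_origin.

(** * Classical supersolution *)

Section barrier_supersolution.
Context {R : realType} {N : nat}.
Variables p gamma : 'I_N -> R.
Hypothesis N_gt0 : (0 < N)%N.
Hypothesis hp : forall i, 1 < p i < 2.
Hypothesis hsum : \sum_i (p i)^-1 < (N%:R + 1) / 2.
Hypothesis gamma_gt0 : forall i, 0 < gamma i.
Hypothesis hgamma : forall i, gamma i <= gamma_bound p i.
Implicit Types (y : 'rV[R]_N) (i j : 'I_N).

Local Notation F := (barrier p gamma).
Local Notation G := (barrier_grad p gamma).
Local Notation m := (barrier_exp p).

Lemma continuous_barrier y : y != 0 -> {for y, continuous F}.
Proof.
move=> y0; have P0 : \sum_j gamma j * `|y ord0 j| `^ m j != 0.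
  by rewrite -invr_eq0 gt_eqF//; exact: (barrier_gt0 p gamma_gt0 y0).
have cPhi : {for y, continuous
    (fun z : 'rV[R]_N => \sum_j gamma j * `|z ord0 j| `^ m j)}.
  rewrite (_ : (fun z => _) = \sum_(j < N)
      (fun z : 'rV[R]_N => gamma j * `|z ord0 j| `^ m j)); last first.
    by apply/funext => z; rewrite fct_sumE.
  apply: (big_ind (fun g : 'rV[R]_N -> R => {for y, continuous g})).
  - exact: (@cst_continuous _ _ (0 : R)).
  - by move=> f g cf cg; exact: cvgD cf cg.
  move=> j _; have cj : {for y, continuous
      (fun z : 'rV[R]_N => `|z ord0 j| `^ m j)}.
    apply: (@continuous_comp _ _ _ (fun z : 'rV[R]_N => z ord0 j)
      (fun x => `|x| `^ m j)); first exact: coord_continuous.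
    by apply: continuous_normr_powR; apply: lt_trans (barrier_exp_gt1 hp j).
  exact: (cvgM (cvg_cst (gamma j)) cj).
exact: cvgV P0 cPhi.
Qed.

Lemma continuous_barrier_powR a y : y != 0 ->
  {for y, continuous (fun z => F z `^ a)}.
Proof.
move=> y0; apply: (@continuous_comp _ _ _ F (fun x => x `^ a)).
  exact: continuous_barrier.
have [d _] := is_derive1_powR a (barrier_gt0 p gamma_gt0 y0).
by apply: differentiable_continuous; exact/derivable1_diffP.
Qed.

Lemma continuous_spow_coord i b y : 0 < b ->
  {for y, continuous (fun z : 'rV[R]_N => spow b (z ord0 i))}.
Proof.
move=> b0; apply: (@continuous_comp _ _ _ (fun z : 'rV[R]_N => z ord0 i) (spow b)).
  exact: coord_continuous.
exact: continuous_spow.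
Qed.

Lemma continuous_barrier_grad i y : y != 0 -> {for y, continuous (G i)}.
Proof.
move=> y0; have cF := continuous_barrier y0.
have m10 : 0 < m i - 1 by rewrite subr_gt0 barrier_exp_gt1.
have cs := continuous_spow_coord (i := i) (y := y) m10.
exact: (cvgN (cvgM (cvgM cF cF)
  (cvgM (cvg_cst (gamma i)) (cvgM (cvg_cst (m i)) cs)))).
Qed.

Lemma continuous_flux_coef i y : y != 0 ->
  {for y, continuous (flux_coef p gamma i)}.
Proof.
move=> y0; have cF := continuous_barrier_powR (a := 2 * (p i - 1)) y0.
exact: (cvgN (cvgM (cvg_cst ((gamma i * m i) `^ (p i - 1))) cF)).
Qed.

Lemma continuous_flux_coef_grad i y : y != 0 ->
  {for y, continuous (flux_coef_grad p gamma i)}.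
Proof.
move=> y0; have cF := continuous_barrier_powR (a := 2 * (p i - 1) - 1) y0.
have cG := continuous_barrier_grad (i := i) y0.
exact: (cvgN (cvgM (cvg_cst ((gamma i * m i) `^ (p i - 1)))
  (cvgM (cvgM (cvg_cst (2 * (p i - 1))) cF) cG))).
Qed.

Lemma continuous_good_flux i y : y != 0 ->
  {for y, continuous (good_flux p gamma i)}.
Proof.
move=> y0; have cs := continuous_spow_coord (i := i) (y := y) (flux_exp_gt0 hp i).
exact: (cvgM (continuous_flux_coef_grad (i := i) y0) cs).
Qed.

Lemma continuous_barrier_flux i y : y != 0 -> {for y, continuous
  (fun z => flux_coef p gamma i z * spow (flux_exp p i) (z ord0 i))}.
Proof.
move=> y0; have cs := continuous_spow_coord (i := i) (y := y) (flux_exp_gt0 hp i).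
exact: (cvgM (continuous_flux_coef (i := i) y0) cs).
Qed.

Lemma continuous_drift i y : y != 0 -> {for y, continuous (drift i F)}.
Proof.
move=> y0; exact: (cvgM (@coord_continuous R 1 N ord0 i y) (continuous_barrier y0)).
Qed.

Lemma continuous_drift_partial i y : y != 0 ->
  {for y, continuous (fun z : 'rV[R]_N => F z + z ord0 i * G i z)}.
Proof.
move=> y0; exact: (cvgD (continuous_barrier y0)
  (cvgM (@coord_continuous R 1 N ord0 i y) (continuous_barrier_grad (i := i) y0))).
Qed.

Lemma barrier_classical_supersolution :
  classical_supersolution p
    [set y : 'rV[R]_N | y != 0 /\ forall i, y ord0 i = 0 -> 3 / 2 <= p i] F.
Proof.
move=> y [y0 yi]; split=> [i|i|i|].
- exact: derivable_barrier.
- by have [] := is_derive_flux hp gamma_gt0 y0 (yi i).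
- by have [] := is_derive_drift hp gamma_gt0 i y0.
apply: le_trans (sum_good_flux_drift_le0 N_gt0 hp hsum gamma_gt0 hgamma y0).
apply: ler_sum => i _.
have [_ fE] := is_derive_flux hp gamma_gt0 y0 (yi i).
have [_ dE] := is_derive_drift hp gamma_gt0 i y0.
rewrite /partial fE dE lerD2r gerDl.
rewrite mulr_le0_ge0//; first by rewrite oppr_le0 mulr_ge0 ?powR_ge0.
by rewrite mulr_ge0 ?powR_ge0// ltW// flux_exp_gt0.
Qed.

(** The flux vanishes at [y], so its quotient is the coefficient at the shifted point times the
    slope of [spow] at 0: a negative limit times [+oo]. *)
Lemma flux_ext_partial i y : y != 0 -> y ord0 i = 0 -> p i < 3 / 2 ->
  is_ext_partial i (flux p i F) y -oo%E.
Proof.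
move=> y0 yi p32.
have q0 := flux_exp_gt0 hp i; have q1 := flux_exp_lt1 hp p32.
have c0 : flux_coef p gamma i y < 0.
  rewrite oppr_lt0 mulr_gt0 ?powR_gt0 ?barrier_gt0// mulr_gt0//.
  exact: lt_trans ltr01 (barrier_exp_gt1 hp i).
have line : (fun h : R => y + h *: basis_vec i) @ (0 : R)^' --> y.
  apply: cvg_within_filter.
  have : y + h *: basis_vec i @[h --> (0 : R)] --> y + (0 : R) *: basis_vec i.
    by apply: cvgD; [exact: cvg_cst|apply: cvgZr_tmp; exact: cvg_id].
  by rewrite scale0r addr0.
have cline : flux_coef p gamma i (y + h *: basis_vec i) @[h --> (0 : R)^'] -->
    flux_coef p gamma i y.
  exact: (cvg_comp _ _ line (continuous_flux_coef (i := i) y0)).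
have n1 : \forall h \near (0 : R)^',
    flux_coef p gamma i (y + h *: basis_vec i) < flux_coef p gamma i y / 2.
  by apply: cvgr_lt cline _ _; lra.
have n2 : \forall h \near (0 : R)^', y + h *: basis_vec i != 0.
  exact: (line _ (near_neq0 y0)).
apply/cvgeNyPle => A.
have qq : 0 < flux_exp p i < 1 by rewrite q0 q1.
(* Near [y] the coefficient is below half its limit c < 0, and c / 2 times a slope of at least 2 |A|
   / (- c) is at most - |A| <= A. *)
have /cvgeyPge/(_ (`|A| * 2 / - flux_coef p gamma i y)) n3 := spow_slope_cvgy qq.
near=> h.
have h2 : y + h *: basis_vec i != 0 by near: h.
have h1 : flux_coef p gamma i (y + h *: basis_vec i) < flux_coef p gamma i y / 2.
  by near: h.
have h3 : `|A| * 2 / - flux_coef p gamma i y <= h^-1 * spow (flux_exp p i) h.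
  by rewrite -lee_fin; near: h.
have : (y + h *: basis_vec i) ord0 i = h by rewrite !mxE yi !eqxx mulr1 add0r.
move: (y + h *: basis_vec i) h1 h2 => z h1 z0 zi.
rewrite lee_fin (fluxE hp gamma_gt0 i z0) (fluxE hp gamma_gt0 i y0).
rewrite zi yi spow0; move: c0 h1 h3.
move: (flux_coef p gamma i y) (flux_coef p gamma i z) (spow (flux_exp p i) h).
move=> c d s c0 dc h3; rewrite mulr0 subr0 mulrCA; set t := h^-1 * s in h3 *.
have t0 : 0 <= t.
  by apply: le_trans h3; rewrite divr_ge0 ?mulr_ge0// oppr_ge0 ltW.
apply: (@le_trans _ _ (c / 2 * t)); first by rewrite ler_wpM2r// ltW.
have : `|A| <= - c / 2 * t.
  by move: h3; rewrite ler_pdivrMr ?oppr_gt0//; lra.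
have := ler_norm (- A); rewrite normrN; lra.
Unshelve. all: by end_near. Qed.

Lemma barrier_ext_classical_supersolution :
  ext_classical_supersolution p (~` [set 0]) F.
Proof.
move=> y /eqP y0.
(* The bound by [good_flux] holds for finite and infinite derivatives alike and reduces the extended
   sum to the real inequality. *)
have /choice[l hl] : forall i, exists l : \bar R,
    is_ext_partial i (flux p i F) y l /\ (l <= (good_flux p gamma i y)%:E)%E.
  move=> i; have [/andP[/eqP yi p32]|h] := boolP ((y ord0 i == 0) && (p i < 3 / 2)).
    by exists -oo%E; split; [exact: flux_ext_partial|exact: leNye].
  have yi : y ord0 i = 0 -> 3 / 2 <= p i.
    by move=> yi; move: h; rewrite yi eqxx/= -leNgt.
  have [d dE] := is_derive_flux hp gamma_gt0 y0 yi.
  exists ('D_(basis_vec i) (flux p i F) y)%:E; split.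
    apply: cvg_EFin; first exact: nearW.
    have E : (fun h : R => h^-1 * (flux p i F (y + h *: basis_vec i) - flux p i F y))
        = (fun h : R => h^-1 *: ((flux p i F \o shift y) (h *: basis_vec i)
                                 - flux p i F y)).
      by apply/funext => k /=; rewrite [y + _]addrC.
    by have := d; rewrite /derivable /derive -E.
  rewrite dE lee_fin gerDl mulr_le0_ge0//.
    by rewrite oppr_le0 mulr_ge0 ?powR_ge0.
  by rewrite mulr_ge0 ?powR_ge0// ltW// flux_exp_gt0.
exists l; split=> [i|i|i|].
- exact: derivable_barrier.
- have [? ll] := hl i; split => //; exact: le_lt_trans ll (ltry _).
- by have [] := is_derive_drift hp gamma_gt0 i y0.
have := sum_good_flux_drift_le0 N_gt0 hp hsum gamma_gt0 hgamma y0.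
rewrite -lee_fin -sumEFin; apply: le_trans; apply: lee_sum => i _.
have [_ dE] := is_derive_drift hp gamma_gt0 i y0.
rewrite /partial dE EFinD leeD2r//; exact: (hl i).2.
Qed.

End barrier_supersolution.

Section Rintegral_sum.
Context d (T : measurableType d) (R : realType).
Variables (mu : {measure set T -> \bar R}) (D : set T) (mD : measurable D).
Variables (I : finType) (f : I -> T -> R).
Hypothesis intf : forall i, mu.-integrable D (EFin \o f i).

Lemma integrable_sum_EFin : mu.-integrable D (EFin \o (fun x => \sum_i f i x)).
Proof.
rewrite (_ : EFin \o _ = (fun x => \sum_i (f i x)%:E)%E); last first.
  by apply/funext => x; rewrite /= sumEFin.
by apply: integrable_sum => // i _; exact: intf.
Qed.

Lemma Rintegral_sum :
  \int[mu]_(x in D) (\sum_i f i x) = \sum_i \int[mu]_(x in D) f i x.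
Proof.
rewrite /Rintegral sum_fine => [|i _]; last first.
  by have := integrable_fin_num mD (intf i).
rewrite -(integral_sum mD intf); congr fine.
by apply: eq_integral => x _ /=; rewrite sumEFin.
Qed.

End Rintegral_sum.

(** * Weak supersolution outside a ball *)

Section weak_supersolution.
Context {R : realType} {N : nat}.
Variables p gamma : 'I_N -> R.
Hypothesis N_gt0 : (0 < N)%N.
Hypothesis hp : forall i, 1 < p i < 2.
Hypothesis hsum : \sum_i (p i)^-1 < (N%:R + 1) / 2.
Hypothesis gamma_gt0 : forall i, 0 < gamma i.
Hypothesis hgamma : forall i, gamma i <= gamma_bound p i.
Variable r : R.
Hypothesis r_gt0 : 0 < r.
Implicit Types (y : 'rV[R]_N) (i j : 'I_N) (phi : 'rV[R]_N -> R).

Local Notation F := (barrier p gamma).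
Local Notation G := (barrier_grad p gamma).
Local Notation mu := (lebesgue_rV N).
Local Notation Omega := (~` closure (eball r) : set 'rV[R]_N).

Let openOmega : open Omega.
Proof. by apply: closed_openC; exact: closed_closure. Qed.

Let Omega_enorm : Omega `<=` [set y | r <= enorm y].
Proof.
move=> y /= Oy; rewrite leNgt; apply/negP => yr.
by apply: Oy; exact: subset_closure.
Qed.

Let Omega_neq0 y : Omega y -> y != 0.
Proof. by move=> /Omega_enorm; exact: enorm_neq0. Qed.

Let bounded_on_Omega f : (forall y, y != 0 -> {for y, continuous f}) ->
  locally_bounded (f \_ Omega).
Proof.
move=> cf.
exact: (continuous_off0_locally_bounded N_gt0 r_gt0 openOmega Omega_enorm cf).
Qed.

Lemma barrier_weak_partial i : is_weak_partial Omega i F (G i).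
Proof.
have bF := bounded_on_Omega (continuous_barrier hp gamma_gt0).
have bG := bounded_on_Omega (continuous_barrier_grad hp gamma_gt0 (i := i)).
split; [exact: locally_bounded_loc_integrable..|move=> phi tphi].
apply: (ibp_eq openOmega tphi bF bG) => y /Omega_neq0 y0.
- exact: derivable_barrier.
- exact: partial_barrier.
- exact: continuous_barrier_grad.
Qed.

(** On [Omega] the barrier is bounded by some c, so |F_i|^p_i <= C F^2 <= C c F, and integrability
    of F is enough. *)
Lemma barrier_grad_Lfun i : G i \_ Omega \in Lfun mu (p i)%:E.
Proof.
have bG := bounded_on_Omega (continuous_barrier_grad hp gamma_gt0 (i := i)).
have p0 : 0 < p i by apply: lt_trans (p_gt1 hp i).
rewrite inE; apply/andP; split; rewrite inE/=; first by have [] := bG.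
rewrite /finite_norm unlock; apply: poweR_lty.
have [c c0 Fc] := barrier_bounded N_gt0 hp gamma_gt0 r_gt0.
pose D : set 'rV[R]_N := ~` eball r.
have iF := integrable_barrier N_gt0 hp hsum gamma_gt0 r_gt0.
have mD : measurable D.
  exact: (measurable_eballC r).
pose C := (gamma i * barrier_exp p i) `^ p i * (gamma i `^ (2 * (p i - 1)))^-1.
have C0 : 0 <= C by rewrite mulr_ge0 ?invr_ge0 ?powR_ge0.
have iCF : mu.-integrable setT (EFin \o (fun y => C * c * (F \_ D) y)).
  apply: (integrableZl measurableT (C * c) (f := EFin \o (F \_ D))).
  by rewrite -restrict_EFin; exact/(integrable_mkcond _ mD).1.
have mG : measurable_fun setT (fun y => `|(G i \_ Omega) y| `^ p i).
  apply: (measurableT_comp (measurable_powR _)).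
  by apply: measurableT_comp => //; have [] := bG.
have : mu.-integrable setT (EFin \o (fun y => `|(G i \_ Omega) y| `^ p i)).
  apply: le_integrable iCF => //; first exact/measurable_EFinP.
  move=> y _ /=; rewrite lee_fin (ger0_norm (powR_ge0 _ _)).
  rewrite [in leLHS]patchE; case: ifPn => [|_]; last first.
    by rewrite normr0 powR0 ?gt_eqF.
  rewrite inE => Oy; have ry := Omega_enorm Oy; have y0 := Omega_neq0 Oy.
  apply: le_trans (ler_norm _); rewrite patchE mem_set; last first.
    by rewrite /D /eball/= => /lt_geF; rewrite ry.
  apply: le_trans (powR_barrier_grad_le hp gamma_gt0 i y0) _.
  rewrite -/C -[leRHS]mulrA; apply: ler_wpM2l => //.
  by rewrite expr2; apply: ler_wpM2r; [exact: barrier_ge0|exact: Fc].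
move=> /integrableP[_].
apply: le_lt_trans; rewrite le_eqVlt; apply/orP; left; apply/eqP.
apply: eq_integral => y _; rewrite [RHS]gee0_abs//.
exact: (powR_ge0 _ _).
Qed.

Lemma barrier_weak_supersolution : weak_supersolution p Omega F.
Proof.
exists (barrier_grad p gamma); split=> [i|i|phi tphi phi0].
- exact: barrier_weak_partial.
- exact: barrier_grad_Lfun.
have mO := open_measurable_rV openOmega.
have bphi := continuous_locally_bounded (test_continuous tphi).
have sphi := test_bounded_support tphi.
have bdphi i := continuous_locally_bounded (test_partial_continuous (i := i) tphi).
have sdphi i := test_partial_bounded_support i tphi.
pose A i y := flux_coef p gamma i y * spow (flux_exp p i) (y ord0 i).
pose B i y := F y + y ord0 i * G i y.
have bA i := bounded_on_Omega (continuous_barrier_flux hp gamma_gt0 (i := i)).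
have bg i := bounded_on_Omega (continuous_good_flux hp gamma_gt0 (i := i)).
have bD i := bounded_on_Omega (continuous_drift hp gamma_gt0 (i := i)).
have bB i := bounded_on_Omega (continuous_drift_partial hp gamma_gt0 (i := i)).
(* The nonpositive C^1 factor is [flux_coef], the increasing one [spow]. The drift is continuously
   differentiable along y_i on [Omega], so its counterpart below is an equality. *)
have fluxle i : - (\int[mu]_(y in Omega) (good_flux p gamma i y * phi y)) <=
    \int[mu]_(y in Omega) (A i y * partial i phi y).
  apply: (ibp_ge0 openOmega tphi phi0 (bA i) (bg i)) => K cK KO eps e0.
  apply: (monotone_product_quotient (u' := flux_coef_grad p gamma i)
    openOmega cK KO) => // [y Oy|y Oy|y Oy|y Oy|h y h0].
  - by apply: is_derive_flux_coef => //; exact: Omega_neq0.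
  - by apply: continuous_flux_coef_grad => //; exact: Omega_neq0.
  - by apply: continuous_spow_coord; exact: flux_exp_gt0.
  - by rewrite oppr_le0 mulr_ge0 ?powR_ge0.
  - apply: ler_spow; first exact: flux_exp_gt0.
    by rewrite !mxE !eqxx mulr1 gerDl oppr_le0 ltW.
have drifteq i : \int[mu]_(y in Omega) (drift i F y * partial i phi y) =
    - \int[mu]_(y in Omega) (B i y * phi y).
  apply: (ibp_eq openOmega tphi (bD i) (bB i)) => y /Omega_neq0 y0.
  - by have [] := is_derive_drift hp gamma_gt0 i y0.
  - by have [] := is_derive_drift hp gamma_gt0 i y0.
  - exact: continuous_drift_partial.
pose H i y := good_flux p gamma i y + alpha p * sigma p i * B i y.
have iH i : mu.-integrable Omega (EFin \o (fun y => H i y * phi y)).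
  apply: restrict_integrable => //.
  rewrite (_ : H i \_ Omega = (fun y => (good_flux p gamma i \_ Omega) y +
      alpha p * sigma p i * (B i \_ Omega) y)).
    apply: locally_boundedD => //.
    by apply: locally_boundedM; [exact: locally_bounded_cst|exact: bB].
  apply/funext => y; rewrite !patchE; case: ifP => // _.
  by rewrite mulr0 addr0.
have HA i : - (\int[mu]_(y in Omega) (H i y * phi y)) <=
    \int[mu]_(y in Omega) ((plap_flux p i (G i y) +
      alpha p * sigma p i * drift i F y) * partial i phi y).
  have -> : \int[mu]_(y in Omega) ((plap_flux p i (G i y) +
      alpha p * sigma p i * drift i F y) * partial i phi y) =
    \int[mu]_(y in Omega) (A i y * partial i phi y) + alpha p * sigma p i *
    \int[mu]_(y in Omega) (drift i F y * partial i phi y).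
    rewrite -RintegralZl//; last exact: restrict_integrable.
    rewrite -RintegralD//; last 2 first.
    - exact: (restrict_integrable mO (bA i)).
    - apply: (integrableZl mO (alpha p * sigma p i)
        (restrict_integrable mO (bD i) (bdphi i) (sdphi i))).
    apply: eq_Rintegral => y _.
    by rewrite (plap_flux_grad hp gamma_gt0) mulrDl -!mulrA.
  have -> : \int[mu]_(y in Omega) (H i y * phi y) =
    \int[mu]_(y in Omega) (good_flux p gamma i y * phi y) +
    alpha p * sigma p i * \int[mu]_(y in Omega) (B i y * phi y).
    rewrite -RintegralZl//; last exact: (restrict_integrable mO (bB i) bphi sphi).
    rewrite -RintegralD//; last 2 first.
    - exact: (restrict_integrable mO (bg i) bphi sphi).
    - exact: (integrableZl mO (alpha p * sigma p i)
        (restrict_integrable mO (bB i) bphi sphi)).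
    by apply: eq_Rintegral => y _; rewrite /H mulrDl -!mulrA.
  by rewrite drifteq mulrN opprD lerD2r.
(* The terms [H i] have no sign individually; the sum is moved inside the integral, where the
   pointwise inequality and [phi >= 0] conclude. *)
apply: (@le_trans _ _ (\sum_i - (\int[mu]_(y in Omega) (H i y * phi y)))).
  rewrite sumrN oppr_ge0 -Rintegral_sum// -oppr_ge0.
  rewrite -mulN1r -RintegralZl//; last exact: integrable_sum_EFin.
  apply: Rintegral_ge0 => y Oy; rewrite mulN1r oppr_ge0 -mulr_suml.
  apply: mulr_le0_ge0 => //.
  exact: (sum_good_flux_drift_le0 N_gt0 hp hsum gamma_gt0 hgamma (Omega_neq0 Oy)).
by apply: ler_sum => i _; exact: HA.
Qed.

End weak_supersolution.

(** The classical claim takes two forms because of the infinite slope on {y_i = 0} when p_i < 3/2: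
    with extended derivatives it holds off the origin, with finite ones off those hyperplanes as
    well. If all p_i >= 3/2, the second set is again the complement of the origin. *)
Theorem proposition7p1 (R : realType) (N : nat) (p gamma : 'I_N -> R)
  (hN : (2 <= N)%N)
  (hp : forall i, 1 < p i < 2)
  (hsum : \sum_i (p i)^-1 < (N%:R + 1) / 2)
  (hgamma : forall i, 0 < gamma i <= gamma_bound p i) :
  (forall r : R, 0 < r ->
     weak_supersolution p (~` closure (eball r)) (barrier p gamma)) /\
  (ext_classical_supersolution p (~` [set 0]) (barrier p gamma) /\
   classical_supersolution p
     [set y : 'rV[R]_N | y != 0 /\ forall i, y ord0 i = 0 -> 3 / 2 <= p i]
     (barrier p gamma)) /\
  (forall r : R, 0 < r ->
     (lebesgue_rV N).-integrable (~` eball r) (EFin \o barrier p gamma)).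
Proof.
have N_gt0 : (0 < N)%N by exact: leq_trans hN.
have gamma_gt0 i : 0 < gamma i by have /andP[] := hgamma i.
have gamma_le i : gamma i <= gamma_bound p i by have /andP[] := hgamma i.
split; [|split; [split|]].
- by move=> r r0; exact: barrier_weak_supersolution.
- exact: barrier_ext_classical_supersolution.
- exact: barrier_classical_supersolution.
- by move=> r r0; exact: integrable_barrier.
Qed.
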